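(* Let $M=(M_k)$ be a weight sequence and let $C^{[M]}$ denote either $C^{(M)}$ or $C^{\{M\}}$. Let $E,F,G$ be convenient vector spaces and let $U\subseteq F$ be $c^\infty$-open. A linear mapping $T:E\to C^{[M]}(U,G)$ is bounded (i.e. maps bounded sets to bounded sets) if and only if $\operatorname{ev}_x\circ T:E\to G$ is bounded for every $x\in U$, where $\operatorname{ev}_x(f)=f(x)$.
   Context: $\mathbb N=\{0,1,2,\dots\}$. A weight sequence $M=(M_k)_{k\in\mathbb N}$ is a sequence of positive reals with $M_0=1\le M_1$. $C^{[M]}$ stands, within one statement, either everywhere for $C^{(M)}$ or everywhere for $C^{\{M\}}$. Jets on Banach spaces. For Banach spaces $E,F$ let $L^k_{\rm sym}(E,F)$ be the Banach space of bounded symmetric $k$-linear maps $E^k\to F$ with the operator norm. For compact $K\subseteq E$ and $f=(f^k)_k\in\prod_k C(K,L^k_{\rm sym}(E,F))$ put $\|f\|_k=\sup_{x\in K}\|f^k(x)\|$, $(R^n_yf)^k(x)=f^k(x)-\sum_{j=0}^n\frac1{j!}f^{j+k}(y)(x-y,\dots,x-y,\cdot)$, $|||f|||_{n,k}=\sup\{(n+1)!\,\|(R^n_yf)^k(x)\|/\|x-y\|^{n+1}:x\ne y\in K\}$, and $$\|f\|_\rho=\max\Big\{\sup_m\frac{\|f\|_m}{m!\rho^mM_m},\ \sup_{n,k}\frac{|||f|||_{n,k}}{(n+k+1)!\rho^{n+k+1}M_{n+k+1}}\Big\}.$$ $C^M_\rho(E\supseteq K,F)$ is the space of those $f$ with $\|f\|_\rho<\infty$,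 normed by $\|\cdot\|_\rho$. For compact convex $K$ put $C^{(M)}(E\supseteq K,F)=\varprojlim_{\rho>0}C^M_\rho(E\supseteq K,F)$ and $C^{\{M\}}(E\supseteq K,F)=\varinjlim_{\rho>0}C^M_\rho(E\supseteq K,F)$ (locally convex limits). For open $U\subseteq E$, $C^{[M]}(U,F)$ is the space of all $C^\infty$ (Fréchet) maps $f:U\to F$ with $j^\infty f|_K=(f^{(k)}|_K)_k\in C^{[M]}(E\supseteq K,F)$ for all compact convex $K\subseteq U$, with the initial locally convex topology induced by the maps $f\mapsto j^\infty f|_K$. Convenient vector spaces. A convenient vector space is a real Hausdorff locally convex space that is Mackey complete. Its $c^\infty$-topology is the final topology with respect to all $C^\infty$-curves $\mathbb R\to E$. A mapping on a $c^\infty$-open set is $C^\infty$ if it maps $C^\infty$-curves to $C^\infty$-curves. $F^*$ is the space of continuous linear functionals. For closed absolutely convex bounded $B\subseteq E$, $E_B$ is the span of $B$ with the Minkowski functional of $B$ as norm (a Banach space), $i_B:E_B\to E$ the inclusion, $U_B=U\cap E_B$. For $c^\infty$-open $U\subseteq E$, $$C^{[M]}(U,F)=\{f\in C^\infty(U,F):\ell\circ f\circ i_B\in C^{[M]}(U_B,\mathbb R)\ \forall\ell\in F^*,\forall B\},$$ with the initial locally convex structure induced by all maps $f\mapsto\ell\circ f\circ i_B\in C^{[M]}(U_B,\mathbb R)$; this is a convenient vector space. *)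

(* Defs.v *)
From HB Require Import structures.
From mathcomp Require Import all_boot all_order all_algebra all_fingroup.
From mathcomp Require Import all_classical all_reals all_analysis.

Set Implicit Arguments.
Unset Strict Implicit.
Unset Printing Implicit Defensive.

Import Order.TTheory GRing.Theory Num.Theory.
Import numFieldNormedType.Exports.

Local Open Scope classical_set_scope.
Local Open Scope ring_scope.

Definition upd (T : Type) k (v : 'I_k -> T) (i : 'I_k) (x : T) : 'I_k -> T :=
  fun j => if j == i then x else v j.

(* The argument tuple (h, ..., h, v_0, ..., v_(k-1)) with h repeated j times. *)
Definition padl (T : Type) j k (h : T) (v : 'I_k -> T) : 'I_(j + k) -> T :=
  fun i => match fintype.split i with inl _ => h | inr i' => v i' end.
Arguments padl {T} j {k} h v _.

Section lsym.
Context {R : realType} {E F : normedModType R} {k : nat}.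
Implicit Types L : ('I_k -> E) -> F.

Definition multilinear L := forall (v : 'I_k -> E) i a x y,
  L (upd v i (a *: x + y)) = a *: L (upd v i x) + L (upd v i y).

Definition symmetric_map L :=
  forall (s : {perm 'I_k}) v, L (fun i => v (s i)) = L v.

Definition bounded_multi L :=
  exists C : R, forall v, `|L v| <= C * \prod_i `|v i|.

Definition lsym_pred : {pred ('I_k -> E) -> F} := fun L =>
  `[< [/\ multilinear L, symmetric_map L & bounded_multi L] >].

Definition opnorm L : R :=
  sup [set `|L v| | v in [set v | forall i, `|v i| <= 1]].

Lemma lsym_submod_closed : submod_closed lsym_pred.
Proof.
split=> [|a L1 L2].
  apply/asboolP; split=> [v i a x y|s v|] /=.
  - by rewrite /= scaler0 addr0.
  - by [].
  - by exists 0 => v; rewrite normr0 mul0r.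
move=> /asboolP[m1 s1 [C1 b1]] /asboolP[m2 s2 [C2 b2]]; apply/asboolP; split.
- move=> v i b x y; rewrite -![(_ + _) _]/(a *: L1 _ + L2 _).
  by rewrite m1 m2 !scalerDr !scalerA [a * b]mulrC addrACA.
- by move=> s v; rewrite -![(_ + _) _]/(a *: L1 _ + L2 _) s1 s2.
- exists (`|a| * C1 + C2) => v; rewrite -![(_ + _) _]/(a *: L1 _ + L2 _).
  rewrite (le_trans (ler_normD _ _))// mulrDl lerD// normrZ -mulrA.
  by rewrite ler_wpM2l.
Qed.

HB.instance Definition _ :=
  GRing.isSubmodClosed.Build R (('I_k -> E) -> F) lsym_pred lsym_submod_closed.

End lsym.

Record Lsym (R : realType) (k : nat) (E F : normedModType R) := MkLsym {
  lsym_fun :> ('I_k -> E) -> F ;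
  lsymP : lsym_fun \in lsym_pred }.

Section lsym_normed.
Context {R : realType} {k : nat} {E F : normedModType R}.
Local Notation L := (Lsym k E F).

HB.instance Definition _ := [isSub for @lsym_fun R k E F].
HB.instance Definition _ := [Choice of L by <:].
HB.instance Definition _ := [SubChoice_isSubLmodule of L by <:].

Lemma lsym_scale (l : L) (c : 'I_k -> R) (v : 'I_k -> E) :
  l (fun i => c i *: v i) = (\prod_i c i) *: l v.
Proof.
have /asboolP[ml _ _] := lsymP l.
have scale1 w i a x : l (upd w i (a *: x)) = a *: l (upd w i x).
  have l0 : l (upd w i 0) = 0.
    have := ml w i 1 0 0; rewrite scale1r scale1r addr0.
    by move/eqP; rewrite -subr_eq0 opprD addrA subrr sub0r oppr_eq0 => /eqP.
  by have := ml w i a x 0; rewrite l0 !addr0.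
have key s : uniq s -> l (fun i => if i \in s then c i *: v i else v i) =
    (\prod_(i <- s) c i) *: l v.
  elim: s => [_|i s IH /= /andP[ins us]].
    by rewrite big_nil scale1r.
  rewrite big_cons -scalerA -IH//.
  pose w j := if j \in s then c j *: v j else v j.
  have -> : (fun j => if j \in i :: s then c j *: v j else v j) =
            upd w i (c i *: v i).
    by apply/funext => j; rewrite /upd /w inE; case: eqVneq => [->|].
  rewrite scale1; congr (_ *: l _); apply/funext => j; rewrite /upd /w.
  by case: eqVneq => [->|//]; rewrite (negbTE ins).
rewrite -big_enum -key ?enum_uniq//; congr (l _).
by apply/funext => i; rewrite mem_enum.
Qed.

Lemma opnorm_has_sup (l : L) :
  has_sup [set `|l v| | v in [set v | forall i, `|v i| <= 1]].
Proof.
split; first by exists `|l (fun=> 0)|, (fun=> 0) => //= i; rewrite normr0.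
have /asboolP[_ _ [C bl]] := lsymP l.
exists `|C| => _ [v v1 <-]; rewrite (le_trans (bl v))//.
rewrite (le_trans (ler_norm _))// normrM -[leRHS]mulr1 ler_wpM2l//.
rewrite ger0_norm ?prodr_ge0//; apply: prodr_ile1 => i _.
by rewrite normr_ge0 v1.
Qed.

Lemma opnorm_ub (l : L) v : (forall i, `|v i| <= 1) -> `|l v| <= opnorm l.
Proof. by move=> v1; apply: ub_le_sup; [exact: (opnorm_has_sup l).2|exists v]. Qed.

Lemma opnorm_ge0 (l : L) : 0 <= opnorm l.
Proof.
by rewrite (le_trans (normr_ge0 (l (fun=> 0))))// opnorm_ub// => i; rewrite normr0.
Qed.

Lemma opnormP (l : L) v : `|l v| <= opnorm l * \prod_i `|v i|.
Proof.
have := @opnorm_ub l (fun i => `|v i|^-1 *: v i) => /= H.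
have -> : v = fun i => `|v i| *: (`|v i|^-1 *: v i).
  apply/funext => i; have [->|vi0] := eqVneq (v i) 0; first by rewrite !scaler0.
  by rewrite scalerA divff ?normr_eq0// scale1r.
rewrite (lsym_scale _ (fun i => `|v i|)) normrZ mulrC.
rewrite normr_prod.
have -> : \prod_i `| `|v i| | = \prod_i `| `|v i| *: (`|v i|^-1 *: v i)|.
  apply: eq_bigr => i _; have [->|vi0] := eqVneq (v i) 0.
    by rewrite !scaler0 !normr0.
  by rewrite scalerA divff ?normr_eq0// scale1r normr_id.
rewrite ler_wpM2r ?prodr_ge0// H// => i; rewrite normrZ normfV normr_id.
have [->|vi0] := eqVneq (v i) 0; first by rewrite normr0 mulr0.
by rewrite mulVf ?normr_eq0.
Qed.

Let ler_opnormD (l1 l2 : L) : opnorm (l1 + l2 : L) <= opnorm l1 + opnorm l2.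
Proof.
apply: sup_le_ub; first exact: (opnorm_has_sup (l1 + l2)).1.
by move=> _ [v v1 <-]; rewrite (le_trans (ler_normD _ _)) ?lerD ?opnorm_ub.
Qed.

Let opnormZ (a : R) (l : L) : opnorm (a *: l : L) = `|a| * opnorm l.
Proof.
have le b (m : L) : opnorm (b *: m : L) <= `|b| * opnorm m.
  apply: sup_le_ub; first exact: (opnorm_has_sup (b *: m)).1.
  move=> _ [v v1 <-]; rewrite -[(lsym_fun _) v]/(b *: m v) normrZ.
  by rewrite ler_wpM2l// opnorm_ub.
apply/eqP; rewrite eq_le le andTb; have [->|a0] := eqVneq a 0.
  by rewrite normr0 mul0r; exact: opnorm_ge0.
have := le a^-1 (a *: l); rewrite scalerA mulVf// scale1r normfV.
by rewrite ler_pdivlMl ?normr_gt0.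
Qed.

Let opnorm_eq0 (l : L) : opnorm l = 0 -> l = 0.
Proof.
move=> l0; apply/val_inj/funext => v /=; apply/eqP; rewrite -normr_le0.
by rewrite (le_trans (opnormP l v))// l0 mul0r.
Qed.

HB.instance Definition _ := @Lmodule_isNormed.Build R L
  (fun l : L => opnorm l) ler_opnormD opnormZ opnorm_eq0.

End lsym_normed.

Section lsym_plug.
Context {R : realType} {E F : normedModType R} (j k : nat).

Lemma lsym_plug_subproof (l : Lsym (j + k) E F) (h : E) :
  (fun v : 'I_k -> E => l (padl j h v)) \in lsym_pred.
Proof.
have /asboolP[ml sl _] := lsymP l; apply/asboolP; split.
- have H v i x : padl j h (upd v i x) = upd (padl j h v) (rshift j i) x.
    apply/funext => a; rewrite /padl /upd; case: (split_ordP a) => b ->.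
      by rewrite eq_lrshift.
    by rewrite (inj_eq (@rshift_inj _ _)).
  by move=> v i a x y; rewrite !H ml.
- move=> s v.
  pose g (a : 'I_(j + k)) := match fintype.split a with
    inl b => lshift k b | inr b => rshift j (s b) end.
  have injg : injective g.
    move=> a b; rewrite /g; case: (split_ordP a) => c ->; case: (split_ordP b) => d ->.
    - by move/lshift_inj ->.
    - by move/eqP; rewrite eq_lrshift.
    - by move/eqP; rewrite eq_rlshift.
    - by move/rshift_inj/perm_inj ->.
  rewrite -(sl (perm injg) (padl j h v)); congr (l _).
  apply/funext => a; rewrite permE /padl /g; case: (split_ordP a) => c _.
    by case: (split_ordP (lshift k c)) => d /eqP; rewrite ?eq_lrshift.
  case: (split_ordP (rshift j (s c))) => d /eqP; rewrite ?eq_rlshift//.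
  by rewrite eq_rshift => /eqP ->.
- exists (opnorm l * `|h| ^+ j) => v; rewrite (le_trans (opnormP _ _))//.
  rewrite big_split_ord/= -mulrA ler_wpM2l ?opnorm_ge0//.
  rewrite le_eqVlt; apply/orP; left; apply/eqP; congr (_ * _).
    under eq_bigr do rewrite /padl (unsplitK (inl _)).
    by rewrite prodr_const card_ord.
  by apply: eq_bigr => i _; rewrite /padl (unsplitK (inr _)).
Qed.

Definition lsym_plug (l : Lsym (j + k) E F) (h : E) : Lsym k E F :=
  MkLsym (lsym_plug_subproof l h).

End lsym_plug.
Arguments lsym_plug {R E F} j {k} l h.

Definition absconvex (R : realType) (V : lmodType R) (A : set V) :=
  A !=set0 /\ forall (a b : R) x y, `|a| + `|b| <= 1 -> A x -> A y ->
    A (a *: x + b *: y).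

(* A locally convex space whose underlying vector space is a subspace of V,
   given by this subspace and by its neighbourhoods of 0. Supersets in V of
   neighbourhoods of 0 are kept; only their trace on the carrier matters. *)
Record lcs (R : realType) (V : lmodType R) := Lcs {
  lcs_carrier : set V ;
  lcs_nbhs0 : set_system V }.

Definition lcs_of_tvs (R : realType) (V : tvsType R) : lcs V :=
  Lcs setT (nbhs (0 : V)).

Definition lcs_bounded (R : realType) (V : lmodType R) (X : lcs V)
    (A : set V) :=
  A `<=` lcs_carrier X /\ forall N, lcs_nbhs0 X N ->
    exists2 r : R, 0 < r & A `<=` [set r *: x | x in N].

Definition bounded_map (R : realType) (V W : lmodType R) (X : lcs V)
    (Y : lcs W) (f : V -> W) :=
  forall A, lcs_bounded X A -> lcs_bounded Y (f @` A).

(* p is meant to be a norm on the vectors of S at which it is finite. *)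
Definition lcs_normed (R : realType) (V : lmodType R) (S : set V)
    (p : V -> \bar R) : lcs V :=
  let X := [set v | S v /\ (p v < +oo)%E] in
  Lcs X [set N | exists2 e : R, 0 < e & X `&` [set v | (p v < e%:E)%E] `<=` N].

Definition lcs_initial (R : realType) (V : lmodType R) (S : set V)
    (I : Type) (D : set I) (W : I -> lmodType R) (f : forall i, V -> W i)
    (X : forall i, lcs (W i)) : lcs V :=
  Lcs [set v | S v /\ forall i, D i -> lcs_carrier (X i) (f i v)]
      (smallest Filter
        (\bigcup_(i in D) [set f i @^-1` N | N in lcs_nbhs0 (X i)])).

(* Projective and inductive limits of subspaces of V ordered by inclusion;
   the latter is given the finest locally convex topology making all the
   inclusions continuous. *)
Definition lcs_projlim (R : realType) (V : lmodType R) (I : Type) (D : set I)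
    (X : I -> lcs V) : lcs V :=
  lcs_initial setT D (fun _ => id) X.

Definition lcs_indlim (R : realType) (V : lmodType R) (I : Type) (D : set I)
    (X : I -> lcs V) : lcs V :=
  let Y := \bigcup_(i in D) lcs_carrier (X i) in
  Lcs Y [set N | exists A, [/\ absconvex A, A `<=` Y,
    (forall i, D i -> lcs_nbhs0 (X i) A) & A `<=` N]].

Definition jet (R : realType) (E F : normedModType R) (X : Type) :=
  forall k : nat, X -> Lsym k E F.

Section jet_lmod.
Context {R : realType} {E F : normedModType R} {X : Type}.
Local Notation J := (jet E F X).
Implicit Types f g h : J.

HB.instance Definition _ := gen_eqMixin J.
HB.instance Definition _ := gen_choiceMixin J.

Let j0 : J := fun _ _ => 0.
Let jadd f g : J := fun k x => f k x + g k x.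
Let jopp f : J := fun k x => - f k x.
Let jscale (a : R) f : J := fun k x => a *: f k x.

Let jext f g : (forall k x, f k x = g k x) -> f = g.
Proof. by move=> fg; apply: functional_extensionality_dep => k; apply/funext. Qed.

Let jaddA : associative jadd.
Proof. by move=> f g h; apply: jext => k x; exact: addrA. Qed.
Let jaddC : commutative jadd.
Proof. by move=> f g; apply: jext => k x; exact: addrC. Qed.
Let jadd0 : left_id j0 jadd.
Proof. by move=> f; apply: jext => k x; exact: add0r. Qed.
Let jaddN : left_inverse j0 jopp jadd.
Proof. by move=> f; apply: jext => k x; exact: addNr. Qed.

HB.instance Definition _ := GRing.isZmodule.Build J jaddA jaddC jadd0 jaddN.

Let jscaleA a b f : jscale a (jscale b f) = jscale (a * b) f.
Proof. by apply: jext => k x; exact: scalerA. Qed.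
Let jscale1 : left_id 1 jscale.
Proof. by move=> f; apply: jext => k x; exact: scale1r. Qed.
Let jscaleDr : right_distributive jscale +%R.
Proof. by move=> a f g; apply: jext => k x; exact: scalerDr. Qed.
Let jscaleDl f : {morph jscale^~ f : a b / a + b}.
Proof. by move=> a b; apply: jext => k x; exact: scalerDl. Qed.

HB.instance Definition _ :=
  GRing.Zmodule_isLmodule.Build R J jscaleA jscale1 jscaleDr jscaleDl.

End jet_lmod.

Variant flavour := Beurling | Roumieu.

Definition weight_sequence (R : realType) (M : nat -> R) :=
  [/\ forall k, 0 < M k, M 0%N = 1 & 1 <= M 1%N].

(* Supremum in [0, +oo], with value 0 on the empty set. *)
Definition sup0 (R : realType) (A : set \bar R) : \bar R :=
  ereal_sup (0%E |` A).

Section jet_spaces.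
Context {R : realType} {E F : normedModType R} (M : nat -> R).

Section norms.
Variable K : set E.
Implicit Types (f : jet E F K) (n k m : nat) (x y : K).

Definition jnorm f m : \bar R := sup0 [set (`|f m x|)%:E | x in [set: K]].

Definition jrem f n k y x : Lsym k E F :=
  f k x - \sum_(j < n.+1) (j`!%:R)^-1 *: lsym_plug j (f (j + k)%N y)
                                           (val x - val y).

Definition jremnorm f n k : \bar R :=
  sup0 [set (n.+1`!%:R * `|jrem f n k xy.2 xy.1|
              / `|val xy.1 - val xy.2| ^+ n.+1)%:E
       | xy in [set xy : K * K | xy.1 <> xy.2]].

Definition jnorm_rho (rho : R) f : \bar R :=
  maxe (sup0 [set (jnorm f m * ((m`!%:R * rho ^+ m * M m)^-1)%:E)%E
             | m in [set: nat]])
       (sup0 [set (jremnorm f nk.1 nk.2 *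
                   (((nk.1 + nk.2).+1`!%N%:R * rho ^+ (nk.1 + nk.2).+1%N
                     * M (nk.1 + nk.2).+1%N)^-1)%:E)%E
             | nk in [set: nat * nat]]).

Definition CM_rho (rho : R) : lcs (jet E F K) :=
  lcs_normed [set f : jet E F K | forall k, continuous (f k)] (jnorm_rho rho).

Definition CM_compact (b : flavour) : lcs (jet E F K) :=
  match b with
  | Beurling => lcs_projlim [set rho : R | 0 < rho] CM_rho
  | Roumieu => lcs_indlim [set rho : R | 0 < rho] CM_rho
  end.

End norms.

Section open_sets.
Variable U : set E.

(* D k extends the k-th Frechet derivative of f to E; its values outside the
   open set U are irrelevant. *)
Definition frechet_derivs (f : U -> F) (D : jet E F E) :=
  (forall (x : U) v, D 0%N (val x) v = f x) /\
  (forall k x, U x -> is_diff x (D k) (fun h => lsym_plug 1 (D (1 + k)%N x) h)).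

Definition frechet_smooth (f : U -> F) := exists D, frechet_derivs f D.

Definition jinf (K : set E) (f : U -> F) : jet E F K :=
  fun k x => xget 0 (frechet_derivs f) k (val x).

Definition CM_open (b : flavour) : lcs (U -> F) :=
  lcs_initial frechet_smooth
    [set K : set E | [/\ compact K, convex_set K & K `<=` U]]
    jinf (fun K => CM_compact K b).

End open_sets.
End jet_spaces.

Section tvs_notions.
Context {R : realType} {E : tvsType R}.

Definition mackey_cauchy (x : nat -> E) := exists B : set E,
  [/\ lcs_bounded (lcs_of_tvs E) B, absconvex B &
   exists2 mu : nat * nat -> R, mu @ (filter_prod \oo \oo) --> (0 : R) &
     forall n m, [set mu (n, m) *: b | b in B] (x n - x m)].

Definition mackey_complete :=
  forall x : nat -> E, mackey_cauchy x ->
    exists l : E, x @ \oo --> l.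

Definition smooth_curve (c : R -> E) := exists2 d : nat -> R -> E, d 0%N = c &
  forall n t, h^-1 *: (d n (t + h) - d n t) @[h --> (0 : R)^'] --> d n.+1 t.

Definition cinfty_open (U : set E) :=
  forall c : R -> E, smooth_curve c -> open (c @^-1` U).

End tvs_notions.
Arguments mackey_complete {R} E.

HB.mixin Record Tvs_isConvenient (R : realType) E of Tvs R E := {
  convenient_hausdorff : hausdorff_space E ;
  convenient_complete : mackey_complete E }.

#[short(type="convenientType")]
HB.structure Definition Convenient (R : realType) :=
  {E of Tvs_isConvenient R E & Tvs R E}.

Definition smooth_map (R : realType) (F G : tvsType R) (U : set F)
    (f : U -> G) :=
  forall c : R -> U, smooth_curve (fun t => val (c t)) ->
    smooth_curve (fun t => f (c t)).

Definition lin_span (R : realType) (V : lmodType R) (B : set V) : set V :=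
  smallest (fun S : set V => submod_closed (fun x => x \in S)) B.

Definition minkowski (R : realType) (V : lmodType R) (B : set V) (x : V) : R :=
  inf [set r | 0 < r /\ [set r *: b | b in B] x].

(* E_B below is built for all such B; Hausdorffness makes the Minkowski
   functional of B definite, and Mackey completeness makes E_B complete. *)
Record bdisk (R : realType) (E : convenientType R) := MkBdisk {
  bdisk_set : set E ;
  bdisk_closed : closed bdisk_set ;
  bdisk_absconvex : absconvex bdisk_set ;
  bdisk_bounded : lcs_bounded (lcs_of_tvs E) bdisk_set }.

Section EB_pred.
Context {R : realType} {E : convenientType R} (B : bdisk E).

Definition EB_pred : {pred E} := fun x => x \in lin_span (bdisk_set B).

Lemma EB_submod_closed : submod_closed EB_pred.
Proof.
split=> [|a x y /set_mem xB /set_mem yB]; apply/mem_set => S [Sc BS].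
  by have [/set_mem] := Sc.
by have [_ Sl] := Sc; apply/set_mem/Sl; apply/mem_set; [exact: xB|exact: yB].
Qed.

HB.instance Definition _ :=
  GRing.isSubmodClosed.Build R E EB_pred EB_submod_closed.

End EB_pred.

Record EB (R : realType) (E : convenientType R) (B : bdisk E) := MkEB {
  EB_incl : E ;
  EB_inclP : EB_incl \in EB_pred B }.

Section EB_normed.
Context {R : realType} {E : convenientType R} (B : bdisk E).

HB.instance Definition _ := [isSub for @EB_incl R E B].
HB.instance Definition _ := [Choice of EB B by <:].
HB.instance Definition _ := [SubChoice_isSubLmodule of EB B by <:].

Local Notation D := (bdisk_set B).
Local Notation S x := [set r | 0 < r /\ [set r *: b | b in D] x].

Let D0 : D 0.
Proof.
have [[x Dx] /(_ 0 0 x x)] := bdisk_absconvex B.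
by rewrite !scale0r addr0 normr0 addr0; apply.
Qed.

Let Sadd x y r s : S x r -> S y s -> S (x + y) (r + s).
Proof.
move=> -[r0 [b Db <-]] [s0 [c Dc <-]]; have rs0 := addr_gt0 r0 s0.
split=> //; exists ((r / (r + s)) *: b + (s / (r + s)) *: c).
  have [_] := bdisk_absconvex B; apply=> //.
  by rewrite !gtr0_norm ?divr_gt0// -mulrDl divff// gt_eqF.
by rewrite scalerDr !scalerA !(mulrC (r + s)) !divfK// gt_eqF.
Qed.

Let Sscale a x r : a != 0 -> S x r -> S (a *: x) (`|a| * r).
Proof.
move=> a0 -[r0 [b Db <-]]; split; first by rewrite mulr_gt0 ?normr_gt0.
exists ((a / `|a|) *: b + 0 *: b).
  have [_] := bdisk_absconvex B; apply=> //.
  by rewrite normrM normfV normr_id divff ?normr_eq0// normr0 addr0.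
rewrite scale0r addr0 !scalerA; congr (_ *: _).
by rewrite mulrAC mulrCA divff ?normr_eq0// mulr1.
Qed.

Let S0 r : 0 < r -> S 0 r.
Proof. by move=> r0; split=> //; exists 0 => //; rewrite scaler0. Qed.

Let Sspan x : x \in EB_pred B -> S x !=set0.
Proof.
move=> /set_mem /(_ [set x | S x !=set0]); apply; split.
  split; first by apply/mem_set; exists 1; exact: S0.
  move=> a y z /set_mem[r Sr] /set_mem[s Ss]; apply/mem_set => /=.
  have [->|a0] := eqVneq a 0; first by exists s; rewrite scale0r add0r.
  by exists (`|a| * r + s); apply: Sadd => //; exact: Sscale.
by move=> y Dy; exists 1; split=> //; exists y => //; rewrite scale1r.
Qed.

Let Sinf x : x \in EB_pred B -> has_inf (S x).
Proof. by move=> /Sspan Sx; split=> //; exists 0 => r [/ltW]. Qed.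

Let mink_lb x r : S x r -> minkowski D x <= r.
Proof. by move=> Sr; apply: ge_inf => //; exists 0 => s [/ltW]. Qed.

Let mink_ge x m : x \in EB_pred B -> (forall r, S x r -> m <= r) ->
  m <= minkowski D x.
Proof. by move=> xB mS; apply: lb_le_inf => //; exact: Sspan. Qed.

Let mink0 : minkowski D 0 = 0.
Proof.
apply/eqP; rewrite eq_le; apply/andP; split; last first.
  by apply: mink_ge => [|r [/ltW]//]; exact: rpred0.
by apply/ler_addgt0Pl => e e0; rewrite addr0 mink_lb//; exact: S0.
Qed.

Let norm (x : EB B) := minkowski D (EB_incl x).

Let ler_normD (x y : EB B) : norm (x + y) <= norm x + norm y.
Proof.
rewrite -lerBlDr; apply: (@mink_ge (EB_incl x) _ (EB_inclP x)) => r Sr.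
rewrite lerBlDr -lerBlDl.
apply: (@mink_ge (EB_incl y) _ (EB_inclP y)) => s Ss.
by rewrite lerBlDl; apply: mink_lb; exact: Sadd.
Qed.

Let normZ (a : R) (x : EB B) : norm (a *: x) = `|a| * norm x.
Proof.
have [->|a0] := eqVneq a 0.
  by rewrite scale0r normr0 mul0r; exact: mink0.
have le b (y : EB B) : b != 0 -> norm (b *: y) <= `|b| * norm y.
  move=> b0; rewrite -ler_pdivrMl ?normr_gt0//.
  apply: (@mink_ge (EB_incl y) _ (EB_inclP y)) => r Sr.
  rewrite ler_pdivrMl ?normr_gt0//; apply: mink_lb; exact: Sscale.
apply/eqP; rewrite eq_le le// andTb.
have := le a^-1 (a *: x); rewrite invr_eq0 => /(_ a0).
by rewrite scalerA mulVf// scale1r normfV ler_pdivlMl ?normr_gt0.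
Qed.

Let norm_eq0 (x : EB B) : norm x = 0 -> x = 0.
Proof.
move=> x0; apply/val_inj/(@convenient_hausdorff R E) => /= N P Nx P0.
exists (EB_incl x); split; first exact: nbhs_singleton.
have := @scale_continuous R E (0, 0) P; rewrite /= scale0r => /(_ P0).
move=> [[V W]/= [/nbhs_ballP[e /= e0 eV] W0] VWP].
have [_ /(_ W W0)[t t0 DW]] := bdisk_bounded B.
have : exists2 r, S (EB_incl x) r & r < e / t.
  apply/not_exists2P => H.
  have : e / t <= norm x.
    apply: (@mink_ge (EB_incl x) _ (EB_inclP x)) => r Sr.
    by case: (H r) => // /negP; rewrite -leNgt.
  by rewrite x0 leNgt divr_gt0.
move=> [r [r0 [b Db <-]] ret].
have [w Ww <-] := DW b Db.
rewrite scalerA; apply: (VWP (r * t, w)); split=> //=.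
apply: eV; rewrite /ball/= sub0r normrN gtr0_norm ?mulr_gt0//.
by rewrite -ltr_pdivlMr.
Qed.

HB.instance Definition _ := @Lmodule_isNormed.Build R (EB B)
  norm ler_normD normZ norm_eq0.

End EB_normed.

Section CM.
Context {R : realType} {F G : convenientType R} (M : nat -> R) (b : flavour).
Variable U : set F.

Definition trace (B : bdisk F) : set (EB B) := [set x | U (EB_incl x)].
Arguments trace B : clear implicits.

Definition trace_incl (B : bdisk F) (x : trace B) : U :=
  exist _ (EB_incl (val x)) (mem_set (set_mem (valP x) : U _)).

Definition CM : lcs (U -> G) :=
  lcs_initial (@smooth_map R F G U)
    [set i : {linear G -> R^o} * bdisk F | continuous i.1]
    (fun i (f : U -> G) (x : trace i.2) => i.1 (f (trace_incl x)) : R^o)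
    (fun i => @CM_open R (EB i.2) R^o M (trace i.2) b).

End CM.
Arguments CM {R F} G M b U.

(* Main.v *)
(** A closed bounded disk B of E spans a Banach space, because E is Mackey
    complete, so the uniform boundedness theorem applies to seminorms on B.  If
    all [ev_x \o T] are bounded, then so are, on every such B, the linear maps
    [e |-> d^k (l \o T e \o i_D) (x) (v)], by induction on k: they are pointwise
    limits of difference quotients, taken along lines, of derivatives of order
    k - 1; lines stay in U for a short time since they are smooth curves.  The
    norm [jnorm_rho] is a supremum of such maps; it is finite at all [T e] for
    every rho, or for some rho = n + 1 depending on e: uniform boundedness then
    yields one n and one bound that are valid on B.  Conversely, boundedness in
    [C^[M]] gives that of [l (T a x)] for every continuous functional l, and
    weakly bounded sets are bounded by Mackey's theorem. *)
Require Import Defs.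
From HB Require Import structures.
From mathcomp Require Import all_boot all_order all_algebra.
From mathcomp Require Import all_classical all_reals all_analysis.
From mathcomp Require Import lra.

Set Implicit Arguments.
Unset Strict Implicit.
Unset Printing Implicit Defensive.

Import Order.TTheory GRing.Theory Num.Theory.
Import numFieldNormedType.Exports.

Local Open Scope classical_set_scope.
Local Open Scope ring_scope.

(** * Disks and seminorms *)

Section disks.
Context {R : realType} {V : lmodType R}.
Implicit Types (A B : set V) (a b r s : R) (x y : V).

Definition absorbing B :=
  forall x, exists2 r : R, 0 < r & [set r *: b | b in B] x.

Lemma absconvex0 B : absconvex B -> B 0.
Proof.
by move=> [[x Bx] /(_ 0 0 x x)]; rewrite !scale0r !(addr0, normr0); exact.
Qed.

Lemma absconvexZ B a x : absconvex B -> `|a| <= 1 -> B x -> B (a *: x).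
Proof.
move=> [_ cB] a1 Bx; have := cB a 0 x x.
by rewrite scale0r addr0 normr0 addr0; apply.
Qed.

Lemma absconvex_scale0 B r : absconvex B -> [set r *: b | b in B] 0.
Proof. by move=> aB; exists 0; [exact: absconvex0|rewrite scaler0]. Qed.

Lemma absconvex_scale_sub B r s : absconvex B -> `|r| <= s ->
  [set r *: b | b in B] `<=` [set s *: b | b in B].
Proof.
move=> aB rs _ [b Bb <-]; have [s0|s0] := eqVneq s 0.
  move: rs; rewrite s0 normr_le0 => /eqP ->.
  by exists b; rewrite ?scale0r.
have {}s0 : 0 < s by rewrite lt_def s0 (le_trans _ rs).
exists ((r / s) *: b); last by rewrite scalerA mulrC divfK ?gt_eqF.
by apply: absconvexZ; rewrite // normf_div (gtr0_norm s0) ler_pdivrMr ?mul1r.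
Qed.

Lemma absconvex_scaleD B r s x y : absconvex B -> 0 <= r -> 0 <= s ->
  [set r *: b | b in B] x -> [set s *: b | b in B] y ->
  [set (r + s) *: b | b in B] (x + y).
Proof.
move=> aB r0 s0 [u Bu <-] [v Bv <-]; have [rs0|rs0] := eqVneq (r + s) 0.
  move: rs0 => /eqP; rewrite paddr_eq0// => /andP[/eqP -> /eqP ->].
  by rewrite !(scale0r, addr0); exact: absconvex_scale0.
exists ((r / (r + s)) *: u + (s / (r + s)) *: v).
  apply: aB.2 => //; rewrite !ger0_norm ?divr_ge0 ?addr_ge0//.
  by rewrite -mulrDl divff.
by rewrite scalerDr !scalerA ![(r + s) * _]mulrC !divfK.
Qed.

Lemma absconvex_of_convex B : B 0 -> (forall x, B x -> B (- x)) ->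
  convex_set B -> absconvex B.
Proof.
move=> B0 BN cB; split; first by exists 0.
have BZ a x : B x -> exists2 u, B u & a *: x = `|a| *: u.
  have [a0|a0] := leP 0 a; first by exists x; rewrite // ger0_norm.
  by exists (- x); [exact: BN|rewrite ltr0_norm// scalerN scaleNr opprK].
have Bconv t x y : 0 <= t -> t <= 1 -> B x -> B y -> B (t *: x + (1 - t) *: y).
  move=> t0 t1 /mem_set Bx /mem_set By.
  exact/set_mem/(cB x y (Itv01 t0 t1) Bx By).
move=> a b x y ab /(BZ a)[u Bu ->] /(BZ b)[v Bv ->].
have [s0|s0] := eqVneq (`|a| + `|b|) 0.
  move: s0 => /eqP; rewrite paddr_eq0// => /andP[/eqP -> /eqP ->].
  by rewrite !scale0r addr0.
have {}s0 : 0 < `|a| + `|b| by rewrite lt_def s0 addr_ge0.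
have Buv : B ((`|a| / (`|a| + `|b|)) *: u + (1 - `|a| / (`|a| + `|b|)) *: v).
  by apply: Bconv; rewrite ?divr_ge0 ?(ltW s0)// ler_pdivrMr// mul1r lerDl.
have := Bconv _ _ _ (ltW s0) ab Buv B0; rewrite scaler0 addr0 scalerDr !scalerA.
rewrite mulrBr mulr1 [_ * (_ / _)]mulrC divfK ?gt_eqF//.
by rewrite [X in X - _]addrC addrK.
Qed.

Lemma absconvex_geometric_tail B q (x : nat -> V) : absconvex B -> 0 < q < 1 ->
  (forall n, [set ((1 - q) * q ^+ n) *: b | b in B] (x n.+1 - x n)) ->
  forall n m, (n <= m)%N -> [set q ^+ n *: b | b in B] (x m - x n).
Proof.
move=> aB /andP[q0 q1] xS n m /subnKC <-; move: (m - n)%N => k.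
have qk i : 0 <= q ^+ i <= 1 by rewrite exprn_ge0 ?exprn_ile1 ?ltW.
have : [set (q ^+ n * (1 - q ^+ k)) *: b | b in B] (x (n + k)%N - x n).
  elim: k => [|k IHk]; first by rewrite addn0 !subrr; exact: absconvex_scale0.
  have := absconvex_scaleD aB _ _ (xS (n + k)%N) IHk.
  have -> : (1 - q) * q ^+ (n + k) + q ^+ n * (1 - q ^+ k) =
    q ^+ n * (1 - q ^+ k.+1) by rewrite exprD exprS; lra.
  rewrite addrA subrK addnS; apply.
    by have := qk (n + k)%N; nra.
  by have := qk n; have := qk k; nra.
apply: absconvex_scale_sub => //.
by have := qk n; have := qk k => *; rewrite ger0_norm; nra.
Qed.

Lemma absconvexI A B : absconvex A -> absconvex B -> absconvex (A `&` B).
Proof.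
move=> aA aB; split; first by exists 0; split; exact: absconvex0.
by move=> a b x y ab [Ax Bx] [Ay By]; split; [apply: aA.2|apply: aB.2].
Qed.

Lemma absconvex_bigcap (I : Type) (D : set I) (F : I -> set V) :
  (forall i, D i -> absconvex (F i)) -> absconvex (\bigcap_(i in D) F i).
Proof.
move=> aF; split; first by exists 0 => i Di; exact: absconvex0 (aF i Di).
move=> a b x y ab Fx Fy i Di.
by apply: (aF i Di).2 => //; [exact: Fx|exact: Fy].
Qed.

Lemma absconvex_bigcup (I : Type) (D : set I) (F : I -> set V) :
  D !=set0 -> (forall i, D i -> absconvex (F i)) ->
  (forall i j, D i -> D j -> exists k, [/\ D k, F i `<=` F k & F j `<=` F k]) ->
  absconvex (\bigcup_(i in D) F i).
Proof.
move=> [i0 Di0] aF dF; split.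
  by exists 0, i0 => //; exact: absconvex0 (aF i0 Di0).
move=> a b x y ab [i Di Fx] [j Dj Fy]; have [k [Dk ik jk]] := dF i j Di Dj.
by exists k => //; apply: (aF k Dk).2 => //; [exact: ik|exact: jk].
Qed.

End disks.

Definition seminorm (R : realType) (V : lmodType R) (p : V -> R) :=
  (forall x y, p (x + y) <= p x + p y) /\ (forall a x, p (a *: x) = `|a| * p x).

Section seminorms.
Context {R : realType} {V : lmodType R}.
Implicit Types x y : V.

Lemma seminorm_norm_linear (W : normedModType R) (f : V -> W) :
  linear f -> seminorm (fun x => `|f x|).
Proof.
move=> /GRing.semilinear_linear[fZ fD].
by split=> [x y|a x]; [rewrite fD ler_normD|rewrite fZ normrZ].
Qed.

Variable p : V -> R.
Hypothesis sp : seminorm p.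

Lemma seminorm0 : p 0 = 0.
Proof. by have := sp.2 0 0; rewrite scale0r normr0 mul0r. Qed.

Lemma seminormN x : p (- x) = p x.
Proof. by rewrite -scaleN1r sp.2 normrN normr1 mul1r. Qed.

Lemma seminorm_ge0 x : 0 <= p x.
Proof. by have := sp.1 x (- x); rewrite subrr seminorm0 seminormN; lra. Qed.

Lemma seminormB x y : p (x - y) <= p x + p y.
Proof. by rewrite -(seminormN y); exact: sp.1. Qed.

Lemma seminorm_dist x y : `|p x - p y| <= p (x - y).
Proof.
have := sp.1 (x - y) y; have := sp.1 (y - x) x.
by rewrite !subrK -(opprB x y) seminormN ler_norml => *; apply/andP; split; lra.
Qed.

Lemma seminorm_mul c : 0 <= c -> seminorm (fun x => c * p x).
Proof.
move=> c0; split=> [x y|a x]; first by rewrite -mulrDr ler_wpM2l ?sp.1.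
by rewrite sp.2 mulrCA.
Qed.

Lemma absconvex_seminorm_ball c : 0 <= c -> absconvex [set x | p x <= c].
Proof.
move=> c0; split; first by exists 0; rewrite /= seminorm0.
move=> a b x y ab /= px py; rewrite (le_trans (sp.1 _ _))// !sp.2.
apply: (@le_trans _ _ ((`|a| + `|b|) * c)); last by rewrite ler_piMl.
by rewrite mulrDl lerD// ler_wpM2l.
Qed.

(* [p (x + y)] and [p (x - y)] have mean at least [p y]. *)
Lemma seminorm_push x y : exists2 e, `|e| <= 1 & p y <= p (x + e *: y).
Proof.
have [le_py|lt_py] := leP (p y) (p (x + y)).
  by exists 1; rewrite ?normr1 ?scale1r.
exists (-1); rewrite ?normrN1// scaleN1r.
have := seminormB (x + y) (x - y).
by rewrite opprB addrC addrA subrK -mulr2n -scaler_nat sp.2 normr_nat; lra.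
Qed.

End seminorms.

(* Unqualified, [minkowski] is Minkowski's inequality. *)
Local Notation gauge := Defs.minkowski.

Section gauge.
Context {R : realType} {V : lmodType R} (B : set V).
Hypothesis aB : absconvex B.
Hypothesis absorbB : absorbing B.

Lemma gauge_le x r : 0 < r -> [set r *: b | b in B] x -> gauge B x <= r.
Proof. by move=> r0 Bx; apply: ge_inf => //; exists 0 => s [/ltW]. Qed.

Let gauge_ge x m :
  (forall r, 0 < r -> [set r *: b | b in B] x -> m <= r) -> m <= gauge B x.
Proof.
move=> mB; apply: lb_le_inf => [|r [r0 Bx]]; last exact: mB.
by have [r r0 Bx] := absorbB x; exists r.
Qed.

Lemma gauge_lt1 x : gauge B x < 1 -> B x.
Proof.
move=> /inf_lt[|r [r0 [b Bb <-]] r1].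
  by have [r r0 Bx] := absorbB x; exists r.
by apply: absconvexZ => //; rewrite gtr0_norm// ltW.
Qed.

Lemma gauge_seminorm : seminorm (gauge B).
Proof.
split=> [x y|a x].
  rewrite -lerBlDr; apply: gauge_ge => r r0 Bx.
  rewrite lerBlDr -lerBlDl; apply: gauge_ge => s s0 By; rewrite lerBlDl.
  apply: gauge_le (addr_gt0 r0 s0) _.
  by apply: absconvex_scaleD => //; exact: ltW.
have gaugeZ_le b y : b != 0 -> gauge B (b *: y) <= `|b| * gauge B y.
  move=> b0; rewrite -ler_pdivrMl ?normr_gt0//.
  apply: gauge_ge => r r0 [u Bu <-].
  rewrite ler_pdivrMl ?normr_gt0//; apply: gauge_le.
    by rewrite mulr_gt0 ?normr_gt0.
  apply: (absconvex_scale_sub (r := b * r)) => //.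
    by rewrite normrM (gtr0_norm r0).
  by exists u; rewrite ?scalerA.
have [->|a0] := eqVneq a 0.
  rewrite scale0r normr0 mul0r; apply/eqP; rewrite eq_le; apply/andP; split.
    apply/ler_addgt0Pl => e e0; rewrite addr0; apply: gauge_le => //.
    exact: absconvex_scale0.
  by apply: gauge_ge => r /ltW.
apply/eqP; rewrite eq_le gaugeZ_le//= -ler_pdivlMl ?normr_gt0// -normfV.
by rewrite -[x in leLHS](scalerK a0) gaugeZ_le ?invr_eq0.
Qed.

End gauge.

(** * Uniform boundedness on Banach disks *)

Section banach_disks.
Context {R : realType} {V : lmodType R}.
Implicit Types (B : set V) (p : V -> R).

(* The space spanned by B and normed by its gauge is complete: for this it is
   enough to sum series whose terms have geometrically decreasing norms.  V has
   no topology, so that the definition applies both to bounded disks of locally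
   convex spaces and to sets of functions. *)
Definition banach_disk B := absconvex B /\
  forall (q : R) (x : nat -> V), 0 < q < 1 -> x 0 = 0 ->
    (forall n, [set ((1 - q) * q ^+ n) *: b | b in B] (x n.+1 - x n)) ->
    exists l, forall n, [set q ^+ n *: b | b in B] (l - x n).

Lemma seminorm_hump B p r x : absconvex B -> seminorm p -> 0 < r ->
  0 < sup (p @` B) ->
  exists b, B b /\ r * (sup (p @` B) / 2) <= p (x + r *: b).
Proof.
move=> aB sp r0 pB0.
have [||_ [b Bb <-] pb] := @sup_gt _ (p @` B) (sup (p @` B) / 2).
- by have [[b Bb] _] := aB; exists (p b), b.
- by lra.
have [e e1 pe] := seminorm_push sp x (r *: b).
exists (e *: b); split; first exact: absconvexZ.
rewrite scalerA [r * e]mulrC -scalerA; apply: le_trans pe.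
by rewrite sp.2 gtr0_norm// ler_pM2l// ltW.
Qed.

(* Sokal's proof of the uniform boundedness theorem: x is the sum of a series
   whose n-th term brings p n to at least (3 / 8) 4^-n sup_B (p n), of which the
   later terms can take back no more than (1 / 4) 4^-n sup_B (p n). *)
Lemma gliding_hump B (p : nat -> V -> R) : banach_disk B ->
  (forall n, seminorm (p n)) -> (forall n, has_ubound (p n @` B)) ->
  (forall n, exists2 b, B b & 8 * 4 ^+ n * n%:R < p n b) ->
  exists2 x, B x & forall n, n%:R < p n x.
Proof.
move=> [aB cB] sp bp large; pose q : R := 4^-1; pose s n := sup (p n @` B).
have q_gt0 n : 0 < q ^+ n by rewrite exprn_gt0// invr_gt0.
have p_le n b : B b -> p n b <= s n.
  by move=> Bb; apply: ub_le_sup (imageP _ Bb).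
have s_large n : 8 * n%:R < q ^+ n * s n.
  have [b Bb /lt_le_trans/(_ (p_le n b Bb))] := large n.
  by rewrite /q exprVn ltr_pdivlMl ?exprn_gt0// mulrCA mulrA.
have s_gt0 n : 0 < s n.
  by rewrite -(pmulr_rgt0 _ (q_gt0 n)) (le_lt_trans _ (s_large n)).
have q1 : 0 < 1 - q by rewrite /q; lra.
have /choice[step stepP] (nx : nat * V) :=
  seminorm_hump nx.2 aB (sp nx.1) (mulr_gt0 q1 (q_gt0 nx.1)) (s_gt0 nx.1).
pose x := fix x n :=
  if n is m.+1 then x m + ((1 - q) * q ^+ m) *: step (m, x m) else 0.
have [||n|l lx] := cB q x.
- by rewrite (q_gt0 1) -subr_gt0.
- by [].
- exists (step (n, x n)); first by have [] := stepP (n, x n).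
  by rewrite /= addrAC subrr add0r.
exists l => [|n]; first by have [b Bb] := lx 0; rewrite subr0 scale1r => <-.
have [b Bb lE] := lx n.+1.
have xl : p n (x n.+1) - p n l <= q ^+ n.+1 * s n.
  rewrite (le_trans (ler_norm _))// (le_trans (seminorm_dist (sp n) _ _))//.
  rewrite -(seminormN (sp n)) opprB -lE (sp n).2 gtr0_norm//.
  by rewrite ler_pM2l// p_le.
have [_ /=] := stepP (n, x n); rewrite -/(s n).
by move: xl (s_large n); rewrite exprS /q /=; lra.
Qed.

Lemma banach_disk_uniform_boundedness B (P : nat -> set (V -> R)) :
  banach_disk B ->
  (forall n p, P n p -> seminorm p /\ has_ubound (p @` B)) ->
  (forall x, B x -> exists n, forall p, P n p -> p x <= n%:R) ->
  exists n c, forall p, P n p -> forall b, B b -> p b <= c.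
Proof.
move=> bB Pp ptb; apply/not_existsP => unb.
have /choice[p pP] n :
    exists p, P n p /\ exists2 b, B b & 8 * 4 ^+ n * n%:R < p b.
  apply: contrapT => no_p; apply: (unb n); exists (8 * 4 ^+ n * n%:R).
  move=> p Pnp b Bb; rewrite leNgt; apply/negP => pb; apply: no_p.
  by exists p; split=> //; exists b.
have [n|n|n|x Bx px] := gliding_hump (p := p) bB.
- by have [/Pp[]] := pP n.
- by have [/Pp[]] := pP n.
- by have [] := pP n.
have [n /(_ _ (pP n).1)] := ptb x Bx.
by rewrite leNgt px.
Qed.

End banach_disks.

(** * The Hahn-Banach theorem *)

Section hahn_banach.
Context {R : realType} {V : lmodType R}.
Implicit Types (p : V -> R) (G H : set (V * R^o)).

Definition sublinear p := (forall x y, p (x + y) <= p x + p y) /\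
  (forall a x, 0 <= a -> p (a *: x) = a * p x).

Lemma seminorm_sublinear p : seminorm p -> sublinear p.
Proof. by move=> [pD pZ]; split=> // a x a0; rewrite pZ ger0_norm. Qed.

(* The graph of a linear functional defined on a subspace; its domination by a
   sublinear p makes it single-valued. *)
Definition dominated_graph p G :=
  (forall a u v, G u -> G v -> G (a *: u + v)) /\
  (forall u, G u -> u.2 <= p u.1).

Section extension.
Variables (p : V -> R) (G : set (V * R^o)).
Hypotheses (sp : sublinear p) (G0 : G 0) (pG : dominated_graph p G).

Let GZ a u : G u -> G (a *: u).
Proof. by move=> Gu; rewrite -[_ *: _]addr0; exact: pG.1. Qed.

Lemma dominated_graph_gap x : exists c, forall u, G u ->
  u.2 - p (u.1 - x) <= c <= p (u.1 + x) - u.2.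
Proof.
have gap u v : G u -> G v -> u.2 - p (u.1 - x) <= p (v.1 + x) - v.2.
  move=> Gu Gv; have := pG.2 _ (pG.1 1 _ _ Gu Gv).
  have := sp.1 (u.1 - x) (v.1 + x).
  by rewrite addrACA addNr addr0 scale1r /=; lra.
have lower_neq0 : [set u.2 - p (u.1 - x) | u in G] !=set0.
  by exists (0 - p (0 - x)), 0.
exists (sup [set u.2 - p (u.1 - x) | u in G]) => u Gu; apply/andP; split.
  apply: ub_le_sup; last by exists u.
  by exists (p (u.1 + x) - u.2) => _ [v Gv <-]; exact: gap.
by apply: ge_sup => // _ [v Gv <-]; exact: gap.
Qed.

Lemma dominated_graph_extend x : exists H, [/\ dominated_graph p H, G `<=` H &
  exists c, H (x, c)].
Proof.
have [c cG] := dominated_graph_gap x; pose xc : V * R^o := (x, c).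
have gap_scale u t : 0 < t -> G u ->
    u.2 - p (u.1 - t *: x) <= t * c <= p (u.1 + t *: x) - u.2.
  move=> t0 /(GZ t^-1)/cG /=; set y := t *: x.
  have -> : x = t^-1 *: y by rewrite scalerK ?gt_eqF.
  rewrite -scalerBr -scalerDr !sp.2 ?invr_ge0 ?(ltW t0)//.
  by rewrite -[_ *: u.2]/(t^-1 * u.2) -!mulrBr ler_pdivrMl// ler_pdivlMl.
exists [set w | exists t, G (w - t *: xc)]; split; last first.
- by exists c, 1; rewrite scale1r subrr.
- by move=> w Gw; exists 0; rewrite scale0r subr0.
split=> [a u v [t Gt] [s Gs]|[y d] [t Gt] /=].
  exists (a * t + s); have := pG.1 a _ _ Gt Gs.
  by rewrite scalerBr scalerDl opprD scalerA addrACA.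
have [t0|t0|t0] := ltgtP t 0.
- have := gap_scale _ (- t) _ Gt; rewrite oppr_gt0 => /(_ t0)/andP[+ _].
  by rewrite scaleNr opprK subrK /= -[_ *: c]/(t * c); lra.
- have /andP[_] := gap_scale _ t t0 Gt.
  by rewrite subrK /= -[_ *: c]/(t * c); lra.
- by have := pG.2 _ Gt; rewrite t0 scale0r subr0.
Qed.

End extension.

Lemma dominated_graph_bigcup p (C : set (set (V * R^o))) :
  total_on C subset -> (forall H, C H -> dominated_graph p H) ->
  dominated_graph p (\bigcup_(H in C) H).
Proof.
move=> Ctot Cp; split=> [a u v [H CH Hu] [K CK Kv]|u [H /Cp[_]]]; last exact.
have [HK|KH] := Ctot H K CH CK.
  by exists K => //; apply: (Cp K CK).1 => //; exact: HK.
by exists H => //; apply: (Cp H CH).1 => //; exact: KH.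
Qed.

Lemma dominated_graph_fun p G u v : sublinear p -> dominated_graph p G ->
  G u -> G v -> u.1 = v.1 -> u.2 = v.2.
Proof.
move=> sp pG; suff val_le w z : G w -> G z -> w.1 = z.1 -> w.2 <= z.2.
  by move=> Gu Gv uv; apply/eqP; rewrite eq_le !val_le.
move=> Gw Gz wz; have := pG.2 _ (pG.1 (-1) _ _ Gz Gw).
rewrite /= wz !scaleN1r addNr; have := sp.2 0 0 (lexx 0).
by rewrite scale0r mul0r => ->; lra.
Qed.

Theorem hahn_banach p G : sublinear p -> G 0 -> dominated_graph p G ->
  exists f : V -> R^o, [/\ scalar f, forall x, f x <= p x &
    forall u, G u -> f u.1 = u.2].
Proof.
move=> sp G0 pG.
have [C CP Ctot|H [[pH GH] Hmax]] := @Zorn_bigcup _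
    [set H | dominated_graph p H /\ (H !=set0 -> G `<=` H)].
  split; first by apply: dominated_graph_bigcup => // H /CP[].
  move=> [u [H CH Hu]] v Gv; exists H => //.
  by apply: (CP H CH).2 => //; exists u.
have {}GH : G `<=` H.
  apply: GH; have [H0|/set0P//] := eqVneq H set0.
  exfalso; apply: (Hmax G); last by split=> [//|_ u].
  by rewrite H0; split=> // /(_ 0 G0).
have /choice[f Hf] x : exists c, H (x, c).
  have [K [pK HK [c Kc]]] := dominated_graph_extend sp (GH 0 G0) pH x.
  exists c; apply: contrapT => nHc; apply: (Hmax K).
    by split=> // /(_ _ Kc).
  by split=> // _ u /GH/HK.
exists f; split=> [a x y|x|u Gu]; last 1 first.
- exact: dominated_graph_fun pH (Hf _) (GH u Gu) _.
- have := pH.1 a _ _ (Hf x) (Hf y).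
  by move/(dominated_graph_fun sp pH (Hf _)); apply.
- exact: pH.2 (Hf x).
Qed.

Corollary seminorm_norming p v : seminorm p ->
  exists f : V -> R^o, [/\ scalar f, forall x, `|f x| <= p x & f v = p v].
Proof.
move=> sp; pose G := [set (t *: v, t * p v) | t in [set: R]].
have [|||f [fl fp fG]] := hahn_banach (p := p) (G := G).
- exact: seminorm_sublinear.
- by exists 0; rewrite // scale0r mul0r.
- split=> [a _ _ [t _ <-] [s _ <-]|_ [t _ <-]] /=.
    by exists (a * t + s); rewrite // scalerDl mulrDl -scalerA -mulrA.
  by rewrite sp.2 ler_wpM2r ?ler_norm// seminorm_ge0.
exists f; split=> // [x|].
  have := fp (- x).
  rewrite -scaleN1r (scalable_linear fl) scaleN1r seminormN//=.
  by rewrite ler_norml fp andbT; lra.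
by apply: (fG (v, p v)); exists 1; rewrite // scale1r mul1r.
Qed.

End hahn_banach.

(** * Bounded sets of locally convex spaces *)

Lemma has_ubound_lt (R : realDomainType) (A : set R) :
  has_ubound A -> exists2 c, 0 < c & forall x, A x -> x < c.
Proof.
move=> [c Ac]; exists (`|c| + 1) => [|x /Ac xc]; first by rewrite ltr_wpDl.
by rewrite (le_lt_trans xc)// (le_lt_trans (ler_norm c))// ltrDl.
Qed.

Section locally_convex_spaces.
Context {R : realType} {E : tvsType R}.
Implicit Types (A N : set E) (p : E -> R).

Lemma nbhs0_absconvex N : nbhs (0 : E) N ->
  exists B, [/\ absconvex B, nbhs (0 : E) B & B `<=` N].
Proof.
have [basis cbasis [obasis nbasis]] := @locally_convex R E.
move=> /nbasis[C [basisC C0] CN].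
have nC : nbhs (0 : E) C by apply: open_nbhs_nbhs; split=> //; exact: obasis.
exists [set x | C x /\ C (- x)]; split.
- apply: absconvex_of_convex => [|x [Cx CNx]|x y t].
  + by rewrite /= oppr0.
  + by rewrite /= opprK.
  + rewrite !inE => -[Cx CNx] [Cy CNy].
    have cC := cbasis C (mem_set basisC).
    split; first exact/set_mem/(cC x y t (mem_set Cx) (mem_set Cy)).
    rewrite /= opprD -!scalerN.
    exact/set_mem/(cC (- x) (- y) t (mem_set CNx) (mem_set CNy)).
- apply: filterI => //; have := @opp_continuous E 0 C; rewrite oppr0.
  exact.
- by move=> x [/CN].
Qed.

Lemma affine_continuous (a : R) (b : E) : continuous (fun x => a *: (x - b)).
Proof.
move=> x; apply: (continuous2_cvg _ (h := fun (c : R^o) (y : E) => c *: y)).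
- exact: (@scale_continuous R E (a, x - b)).
- exact: cvg_cst.
- apply: (continuous2_cvg _ (h := fun y z : E => y + z)).
  + exact: (@add_continuous E (x, - b)).
  + exact: cvg_id.
  + exact: cvg_cst.
Qed.

Lemma nbhs0_absorbing N : nbhs (0 : E) N -> absorbing N.
Proof.
move=> N0 x; have := @scale_continuous R E (0, x) N; rewrite /= scale0r.
move=> /(_ N0)[[P Q] /= [P0 Qx] PQN].
have [t [t0 Pt]] : exists t : R, 0 < t /\ P t.
  apply: (@filter_ex _ (0 : R)^'+); apply: filterI; first exact: nbhs_right_gt.
  exact: cvg_at_right_filter P0.
exists t^-1; first by rewrite invr_gt0.
exists (t *: x); last by rewrite scalerK ?gt_eqF.
exact: PQN (t, x) (conj Pt (nbhs_singleton Qx)).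
Qed.

Lemma nbhs_seminorm_ball p x e : seminorm p -> nbhs (0 : E) [set y | p y < 1] ->
  0 < e -> nbhs x [set y | p (y - x) < e].
Proof.
move=> sp p1 e0.
apply: filterS (nbhsT x (nbhs0Z (lt0r_neq0 e0) p1)) => _ [_ [y py <-] <-] /=.
by rewrite addrAC subrr add0r sp.2 gtr0_norm// gtr_pMr.
Qed.

Definition continuous_seminorm p := seminorm p /\ continuous p.

Lemma continuous_seminorm_nbhs0 p : seminorm p ->
  nbhs (0 : E) [set x | p x < 1] -> continuous_seminorm p.
Proof.
move=> sp p1; split=> // x; apply/cvgrPdist_lt => e e0.
apply: filterS (nbhs_seminorm_ball x sp p1 e0) => y /=; rewrite distrC.
exact: le_lt_trans (seminorm_dist sp y x).
Qed.

Lemma continuous_seminorm_lt1 p : continuous_seminorm p ->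
  nbhs (0 : E) [set x | p x < 1].
Proof.
by move=> [sp cp]; apply: (cvgr_lt _ (cp 0)); rewrite seminorm0.
Qed.

Lemma nbhs0_seminorm N : nbhs (0 : E) N ->
  exists2 p, continuous_seminorm p & [set x | p x < 1] `<=` N.
Proof.
move=> /nbhs0_absconvex[B [aB B0 BN]]; have absB := nbhs0_absorbing B0.
exists (gauge B); last by move=> x /(gauge_lt1 aB absB)/BN.
apply: continuous_seminorm_nbhs0; first exact: gauge_seminorm.
have h0 : (2^-1 : R) != 0 by rewrite invr_eq0 pnatr_eq0.
apply: filterS (nbhs0Z h0 B0) => _ [b Bb <-] /=.
apply: (@le_lt_trans _ _ 2^-1); last by lra.
by apply: gauge_le; [lra|exists b].
Qed.

Lemma normr_continuous_seminorm (W : normedModType R) (f : E -> W) :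
  linear f -> continuous f -> continuous_seminorm (fun x => `|f x|).
Proof.
move=> lf cf; split; first exact: seminorm_norm_linear.
by move=> x; apply: cvg_norm; exact: cf.
Qed.

Lemma dominated_continuous (W : normedModType R) (f : E -> W) p :
  continuous_seminorm p -> linear f -> (forall x, `|f x| <= p x) ->
  continuous f.
Proof.
move=> cp lf fp x; apply/cvgrPdist_lt => e e0.
have p1 := continuous_seminorm_lt1 cp.
apply: filterS (nbhs_seminorm_ball x cp.1 p1 e0) => y /=.
by rewrite distrC -(zmod_morphism_linear lf); exact: le_lt_trans.
Qed.

Lemma lcs_boundedP A : lcs_bounded (lcs_of_tvs E) A <->
  forall p, continuous_seminorm p -> has_ubound (p @` A).
Proof.
split=> [[_ bA] p cp|bA].
  have [r r0 Ar] := bA _ (continuous_seminorm_lt1 cp).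
  exists r => _ [_ /Ar[x /ltW px <-] <-].
  by rewrite cp.1.2 gtr0_norm// ger_pMr.
split=> // N /nbhs0_seminorm[p cp pN].
have [c c0 Ac] := has_ubound_lt (bA p cp).
exists c => // a Aa; exists (c^-1 *: a); last first.
  by rewrite scalerA divff ?gt_eqF// scale1r.
apply: pN; rewrite /= cp.1.2 gtr0_norm ?invr_gt0// ltr_pdivrMl// mulr1.
by apply: Ac; exists a.
Qed.

Definition disk_hull A : set E := smallest [set B | closed B /\ absconvex B] A.

Lemma closed_disk_hull A : closed (disk_hull A).
Proof. by apply: closed_bigI => B [[]]. Qed.

Lemma absconvex_disk_hull A : absconvex (disk_hull A).
Proof. by apply: absconvex_bigcap => B [[]]. Qed.

Lemma bounded_disk_hull A : lcs_bounded (lcs_of_tvs E) A ->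
  lcs_bounded (lcs_of_tvs E) (disk_hull A).
Proof.
move=> /lcs_boundedP bA; apply/lcs_boundedP => p cp.
have [c c0 Ac] := has_ubound_lt (bA p cp); exists c => _ [x Ax <-].
apply: (smallest_sub _ _ Ax (X := [set y | p y <= c])) => [|a Aa].
  split; last by apply: absconvex_seminorm_ball; [exact: cp.1|exact: ltW].
  exact: (continuous_closedP p).1 cp.2 _ (@closed_le _ c).
by apply/ltW/Ac; exists a.
Qed.

End locally_convex_spaces.

Definition hull_bdisk (R : realType) (E : convenientType R) (A : set E)
    (bA : lcs_bounded (lcs_of_tvs E) A) : bdisk E :=
  MkBdisk (@closed_disk_hull _ _ A) (absconvex_disk_hull A)
    (bounded_disk_hull bA).

(** * Banach disks *)

Lemma mackey_complete_banach_disk (R : realType) (E : tvsType R) (B : set E) :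
  mackey_complete E -> closed B -> absconvex B ->
  lcs_bounded (lcs_of_tvs E) B -> banach_disk B.
Proof.
move=> cE clB aB bB; split=> // q x q01 _ /(absconvex_geometric_tail aB q01) xB.
have /andP[q0 q1] := q01; have qn0 n : 0 < q ^+ n by rewrite exprn_gt0.
have [|l xl] := cE x.
  exists B; split=> //; exists (fun nm => q ^+ nm.1 + q ^+ nm.2).
    have q_cvg0 : q ^+ n @[n --> \oo] --> (0 : R).
      by apply: cvg_expr; rewrite gtr0_norm.
    rewrite -[X in _ --> X](addr0 0); apply: cvgD.
      exact: cvg_comp cvg_fst q_cvg0.
    exact: cvg_comp cvg_snd q_cvg0.
  move=> n m; have [nm|/ltnW mn] := leqP n m.
    have [b Bb bE] := xB n m nm.
    apply: (absconvex_scale_sub (r := - q ^+ n)) => //.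
      by rewrite normrN gtr0_norm// lerDl ltW.
    by exists b; rewrite // scaleNr bE opprB.
  by apply: absconvex_scale_sub (xB m n mn); rewrite // gtr0_norm// lerDr ltW.
exists l => n; exists ((q ^+ n)^-1 *: (l - x n)); last first.
  by rewrite scalerA divff ?gt_eqF// scale1r.
have : (q ^+ n)^-1 *: (x m - x n) @[m --> \oo] --> (q ^+ n)^-1 *: (l - x n).
  apply: (cvg_comp x (fun y => (q ^+ n)^-1 *: (y - x n)) xl).
  exact: affine_continuous.
apply: closed_cvg => //.
apply: filterS (nbhs_infty_ge n) => m /(xB n m)[b Bb <-].
by rewrite scalerK ?gt_eqF.
Qed.

Lemma bdisk_banach_disk (R : realType) (E : convenientType R) (B : bdisk E) :
  banach_disk (bdisk_set B).
Proof.
apply: mackey_complete_banach_disk.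
- exact: convenient_complete.
- exact: bdisk_closed.
- exact: bdisk_absconvex.
- exact: bdisk_bounded.
Qed.

Lemma linear_combination (R : comPzRingType) (V W : lmodType R) (a b : R)
    (f g : V -> W) : linear f -> linear g -> linear (a *: f + b *: g).
Proof.
move=> fl gl c x y; rewrite -![(_ + _) _]/(a *: f _ + b *: g _) fl gl.
by rewrite !scalerDr !scalerA ![c * _]mulrC addrACA.
Qed.

Lemma linear_cvg (R : realType) (V : lmodType R) (W : normedModType R)
    (T : Type) (F : set_system T) {FF : ProperFilter F} (f : T -> V -> W)
    (g : V -> W) :
  (forall t, linear (f t)) -> (forall x, f t x @[t --> F] --> g x) -> linear g.
Proof.
move=> fl fg a x y.
have : f t (a *: x + y) @[t --> F] --> a *: g x + g y.
  have -> : f ^~ (a *: x + y) = fun t => a *: f t x + f t y.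
    by apply/funext => t; exact: fl.
  by apply: cvgD (fg y); exact: cvgZ (cvg_cst a) (fg x).
exact: cvg_unique (fg _).
Qed.

Lemma geometric_cvg (R : realType) (X : completeNormedModType R) (q c : R)
    (x : nat -> X) : 0 < q < 1 ->
  (forall n, `|x n.+1 - x n| <= (1 - q) * q ^+ n * c) ->
  exists l, x n @[n --> \oo] --> l /\ forall n, `|l - x n| <= q ^+ n * c.
Proof.
move=> q01 xS; have /andP[q0 q1] := q01.
have r0 n : 0 < (1 - q) * q ^+ n by rewrite mulr_gt0 ?subr_gt0 ?exprn_gt0.
have c0 : 0 <= c by rewrite -(pmulr_rge0 _ (r0 0)) (le_trans _ (xS 0)).
have norm_sp : seminorm (fun y : X => `|y|).
  exact: (seminorm_norm_linear (f := id)).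
have aball := absconvex_seminorm_ball norm_sp c0.
have x_step n : [set ((1 - q) * q ^+ n) *: b | b in [set b : X | `|b| <= c]]
    (x n.+1 - x n).
  exists (((1 - q) * q ^+ n)^-1 *: (x n.+1 - x n)).
    by rewrite /= normrZ gtr0_norm ?invr_gt0// ler_pdivrMl.
  by rewrite scalerA divff ?gt_eqF// scale1r.
have x_tail n m : (n <= m)%N -> `|x m - x n| <= q ^+ n * c.
  move=> nm; have [b bc <-] := absconvex_geometric_tail aball q01 x_step nm.
  by rewrite normrZ gtr0_norm ?exprn_gt0// ler_pM2l ?exprn_gt0.
have /cvg_ex[l xl] : cvgn x.
  apply/cauchy_cvgP/cauchy_exP => e e0.
  have qc0 : q ^+ n * c @[n --> \oo] --> (0 : R).
    rewrite -[X in _ --> X](mul0r c); apply: cvgMr_tmp.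
    by apply: cvg_expr; rewrite gtr0_norm.
  have [n qe] : exists n, q ^+ n * c < e.
    by apply: (@filter_ex _ \oo); exact: cvgr_lt qc0 _ e0.
  exists (x n).
  apply: (@filterS _ \oo _ _ _ _ (nbhs_infty_ge n)) => m /x_tail xm.
  by rewrite /= -ball_normE /= distrC (le_lt_trans xm).
exists l; split=> // n.
have xln : `|x m - x n| @[m --> \oo] --> `|l - x n|.
  by apply: cvg_norm; exact: cvgB xl (cvg_cst _).
apply: (cvgr_to_le xln); apply: filterS (nbhs_infty_ge n) => m; exact: x_tail.
Qed.

Section dominated_maps.
Context {R : realType} {V : lmodType R} {W : normedModType R} (p : V -> R).
Hypothesis sp : seminorm p.

Definition dominated_maps : set (V -> W) :=
  [set f | linear f /\ forall x, `|f x| <= p x].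

Lemma absconvex_dominated_maps : absconvex dominated_maps.
Proof.
split.
  exists (fun=> 0); split=> [a x y|x]; first by rewrite scaler0 addr0.
  by rewrite normr0 seminorm_ge0.
move=> a b f g ab [fl fp] [gl gp].
split=> [|x]; first exact: linear_combination.
rewrite -![(_ + _) _]/(a *: f x + b *: g x).
rewrite (le_trans (ler_normD _ _))// !normrZ.
have px0 := seminorm_ge0 sp x.
apply: (@le_trans _ _ (`|a| * p x + `|b| * p x)).
  by rewrite lerD// ler_wpM2l.
by rewrite -mulrDl ler_piMl.
Qed.

End dominated_maps.

Lemma dominated_maps_banach_disk (R : realType) (V : lmodType R)
    (W : completeNormedModType R) (p : V -> R) :
  seminorm p -> banach_disk (@dominated_maps R V W p).
Proof.
move=> sp; split=> [|q x q01 x0 xS]; first exact: absconvex_dominated_maps.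
have /andP[q0 q1] := q01.
have r0 n : 0 < (1 - q) * q ^+ n by rewrite mulr_gt0 ?subr_gt0 ?exprn_gt0.
have xl n : linear (x n).
  elim: n => [|n IHn]; first by rewrite x0 => a y z; rewrite scaler0 addr0.
  have [b [bl _] bE] := xS n.
  have -> : x n.+1 = 1 *: x n + ((1 - q) * q ^+ n) *: b.
    by rewrite bE scale1r addrC subrK.
  exact: linear_combination.
have /choice[l xlim] y : exists l, x n y @[n --> \oo] --> l /\
    forall n, `|l - x n y| <= q ^+ n * p y.
  apply: geometric_cvg => // n; have [b [_ bp] bE] := xS n.
  rewrite -[x n.+1 y - x n y]/((x n.+1 - x n) y) -bE.
  by rewrite normrZ gtr0_norm// ler_pM2l.
have ll : linear l.
  exact: (@linear_cvg _ _ _ _ \oo _ _ _ xl (fun y => (xlim y).1)).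
exists l => n; exists ((q ^+ n)^-1 *: (l - x n)); last first.
  by rewrite scalerA divff ?scale1r// gt_eqF// exprn_gt0.
split=> [|y].
  by rewrite scalerBr -scaleNr; exact: linear_combination.
rewrite -[(_ *: _) y]/((q ^+ n)^-1 *: (l y - x n y)) normrZ.
rewrite gtr0_norm ?invr_gt0 ?exprn_gt0// ler_pdivrMl ?exprn_gt0//.
by have [_] := xlim y.
Qed.

(* Mackey's theorem: by Hahn-Banach, [p a] is the maximum of the [`|f a|] for f
   in the Banach disk of the functionals dominated by p. *)
Theorem weakly_bounded_bounded (R : realType) (E : tvsType R) (A : set E) :
  (forall l : {linear E -> R^o}, continuous l ->
    has_ubound [set `|l a| | a in A]) ->
  lcs_bounded (lcs_of_tvs E) A.
Proof.
move=> wA; apply/lcs_boundedP => p cp; have sp := cp.1.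
have bP := dominated_maps_banach_disk R^o sp.
have [||_ [c evA]] := banach_disk_uniform_boundedness
  (P := fun=> [set (fun f : E -> R^o => `|f a|) | a in A]) bP.
- move=> _ _ [a _ <-]; split.
    exact: (seminorm_norm_linear (f := fun f : E -> R^o => f a)).
  by exists (p a) => _ [f [_ fp] <-]; exact: fp.
- move=> f [fl fp].
  pose l : {linear E -> R^o} :=
    HB.pack f (GRing.isLinear.Build R E R^o *:%R f fl).
  have [c lc] := wA l (dominated_continuous cp fl fp).
  exists (Num.truncn c).+1 => _ [a Aa <-].
  exact: le_trans (lc _ (imageP _ Aa)) (ltW (truncnS_gt c)).
exists c => _ [a Aa <-]; have [f [fl fp <-]] := seminorm_norming a sp.
by rewrite (le_trans (ler_norm _))// (evA _ (imageP _ Aa) f).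
Qed.

(** * Derivatives of a linear family of smooth maps *)

Section bounded_linear_maps.
Context {R : realType} {V : lmodType R} {W : normedModType R} (B : set V).

Definition bounded_linear_on : {pred V -> W} := fun f =>
  `[< linear f /\ has_ubound [set `|f b| | b in B] >].

Lemma bounded_linear_on_submod_closed : submod_closed bounded_linear_on.
Proof.
split=> [|a f g /asboolP[fl [c fc]] /asboolP[gl [d gd]]]; apply/asboolP; split.
- by move=> a x y; rewrite scaler0 addr0.
- by exists 0 => _ [b _ <-]; rewrite normr0.
- by rewrite -[g]scale1r; exact: linear_combination.
exists (`|a| * c + d) => _ [b Bb <-]; rewrite -[(_ + _) b]/(a *: f b + g b).
rewrite (le_trans (ler_normD _ _))// normrZ.
by rewrite lerD// ?gd ?ler_wpM2l ?fc//; exists b.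
Qed.

HB.instance Definition _ := GRing.isSubmodClosed.Build R (V -> W)
  bounded_linear_on bounded_linear_on_submod_closed.

Lemma bounded_linear_on_cvg (f : nat -> V -> W) (g : V -> W) : banach_disk B ->
  (forall n, f n \in bounded_linear_on) ->
  (forall x, f n x @[n --> \oo] --> g x) -> g \in bounded_linear_on.
Proof.
move=> bB fB fg.
have /all_and2[fl fb] n : linear (f n) /\ has_ubound [set `|f n b| | b in B].
  exact/asboolP/fB.
apply/asboolP; split; first exact: (@linear_cvg _ _ _ _ \oo _ f g).
have [_ _ [n _ <-]|x Bx|_ [c fc]] := @banach_disk_uniform_boundedness _ _ B
    (fun=> [set (fun x => `|f n x|) | n in [set: nat]]) bB.
- by split; [exact: seminorm_norm_linear|exact: fb].
- have /cvg_seq_bounded/pinfty_ex_gt0[c c0 /= fc] : cvgn (f ^~ x).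
    by apply/cvg_ex; exists (g x).
  exists (Num.truncn c).+1 => _ [n _ <-].
  exact: le_trans (fc n I) (ltW (truncnS_gt c)).
exists c => _ [b Bb <-].
have fgb : `|f n b| @[n --> \oo] --> `|g b| by apply: cvg_norm; exact: fg.
apply: (cvgr_to_le fgb); near=> n.
by apply: (fc (fun x => `|f n x|)) => //; exists n.
Unshelve. all: by end_near. Qed.

End bounded_linear_maps.

Section frechet_derivatives.
Context {R : realType} {X F : normedModType R} (U : set X).
Implicit Types (f : U -> F) (D : jet X F X).

Definition frechet_jet f : jet X F X := xget 0 (frechet_derivs f).

Lemma frechet_jetP f : frechet_smooth f -> frechet_derivs f (frechet_jet f).
Proof. by move=> [D fD]; exact: xgetPex (ex_intro _ D fD). Qed.

Lemma padl1 k (v : 'I_k.+1 -> X) :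
  padl 1 (v ord0) (fun i => v (lift ord0 i)) = v.
Proof.
apply/funext => i; rewrite /padl; case: (split_ordP i) => j ->.
  by congr v; apply/val_inj; rewrite /= (ord1 j).
by congr v; apply/val_inj.
Qed.

Lemma lsym_cvg_eval (T : Type) (P : set_system T) {FP : Filter P} k
    (l : T -> Lsym k X F) (m : Lsym k X F) (v : 'I_k -> X) :
  l t @[t --> P] --> m -> l t v @[t --> P] --> m v.
Proof.
move=> lm; apply/cvgrPdist_le => e e0; pose C := \prod_i `|v i| + 1.
have C0 : 0 < C by rewrite ltr_wpDl// prodr_ge0.
have /cvgrPdist_le/(_ (e / C) (divr_gt0 e0 C0)) := lm.
apply: filterS => t mlt; rewrite -[m v - l t v]/((m - l t) v).
rewrite (le_trans (opnormP _ _))//.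
apply: (@le_trans _ _ (e / C * C)); last by rewrite divfK ?gt_eqF.
by rewrite ler_pM ?opnorm_ge0 ?prodr_ge0// lerDl.
Qed.

Lemma frechet_derivs_cvg f D k x (v : 'I_k.+1 -> X) :
  frechet_derivs f D -> U x ->
  t^-1 *: (D k (t *: v ord0 + x) (fun i => v (lift ord0 i)) -
           D k x (fun i => v (lift ord0 i))) @[t --> (0 : R)^'] --> D k.+1 x v.
Proof.
move=> [_ dD] Ux; have [dfx dE] := dD k x Ux.
pose h := v ord0; pose w (i : 'I_k) := v (lift ord0 i).
have quotient_cvg : t^-1 *: (D k (t *: h + x) - D k x) @[t --> (0 : R)^'] -->
    lsym_plug 1 (D (1 + k)%N x) h.
  rewrite -[lsym_plug _ _ _]/((fun h => lsym_plug 1 (D (1 + k)%N x) h) h) -dE.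
  by rewrite -deriveE//; exact: diff_derivable.
have := lsym_cvg_eval (FP := dnbhs_filter 0) (v := w) quotient_cvg.
by rewrite -[lsym_plug _ _ _ _]/(D k.+1 x (padl 1 h _)) padl1.
Qed.

End frechet_derivatives.

Definition algebraically_open (R : realType) (V : lmodType R) (U : set V) :=
  forall x h, U x -> \forall t \near (0 : R), U (t *: h + x).

Lemma cvg_harmonic_dnbhs0 (R : realType) :
  n.+1%:R^-1 @[n --> \oo] --> (0 : R)^'.
Proof.
move=> P /= P0; have := @cvg_harmonic R _ P0.
apply: (@filterS _ \oo) => n; apply.
by rewrite /harmonic /= invr_eq0 pnatr_eq0.
Qed.

(* Derivatives are iterated limits of difference quotients of values. *)
Lemma bounded_linear_on_frechet_jet (R : realType) (V : lmodType R) (B : set V)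
    (X W : normedModType R) (U : set X) (f : V -> U -> W) :
  banach_disk B -> algebraically_open U -> (forall e, frechet_smooth (f e)) ->
  (forall x, f ^~ x \in bounded_linear_on B) ->
  forall k x (v : 'I_k -> X), U x ->
    (fun e => frechet_jet (f e) k x v) \in bounded_linear_on B.
Proof.
move=> bB oU sf fB; elim=> [|k IHk] x v Ux.
  pose xU : U := exist _ x (mem_set Ux).
  have -> : (fun e => frechet_jet (f e) 0 x v) = f ^~ xU; last exact: fB.
  by apply/funext => e; have [/(_ xU v) <-] := frechet_jetP (sf e).
have /(@cvg_harmonic R)[N _ UN] := oU x (v ord0) Ux.
pose w i := v (lift ord0 i).
pose quotient (t : R) e : W := t^-1 *:
  (frechet_jet (f e) k (t *: v ord0 + x) w - frechet_jet (f e) k x w).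
apply: (bounded_linear_on_cvg (f := fun n => quotient (n + N).+1%:R^-1)) => //.
  move=> n; apply: (@rpredZ _ _ (bounded_linear_on B)).
  by apply: rpredB; apply: IHk => //; apply: UN; rewrite /= leq_addl.
move=> e; rewrite (@cvg_shiftn N W (fun n => quotient n.+1%:R^-1 e)).
apply: (cvg_comp _ (quotient ^~ e) (@cvg_harmonic_dnbhs0 R)).
exact: frechet_derivs_cvg (frechet_jetP (sf e)) Ux.
Qed.

Lemma smooth_curve_line (R : realType) (E : tvsType R) (x h : E) :
  smooth_curve (fun t : R => t *: h + x).
Proof.
exists (fun n t => match n with 0 => t *: h + x | 1 => h | _ => 0 end) => //.
move=> [|[|n]] t; apply: cvg_near_cst;
  apply: filterS (nbhs_dnbhs_neq 0) => s s0.
- by rewrite opprD addrACA subrr addr0 -scalerBl addrAC subrr add0r scalerK.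
- by rewrite subrr scaler0.
- by rewrite subrr scaler0.
Qed.

Lemma cinfty_open_algebraically_open (R : realType) (E : tvsType R)
    (U : set E) : cinfty_open U -> algebraically_open U.
Proof.
move=> oU x h Ux; have := oU _ (smooth_curve_line x h).
by rewrite openE => /(_ 0); apply; rewrite /= scale0r add0r.
Qed.

(** * Norms of jets *)

Lemma sup0_leP (R : realType) (A : set \bar R) (c : R) : 0 <= c ->
  (Defs.sup0 A <= c%:E)%E <-> forall a, A a -> (a <= c%:E)%E.
Proof.
move=> c0; split=> [Ac a Aa|Ac].
  by apply: le_trans Ac; apply: ereal_sup_ubound; right.
by apply: ge_ereal_sup => a [->|/Ac//]; rewrite lee_fin.
Qed.

Section jet_norms.
Context {R : realType} {X F : normedModType R} (M : nat -> R) (K : set X).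
Hypothesis wM : weight_sequence M.
Local Notation J := (jet X F K).
Implicit Types (g h : J) (rho c : R).

Lemma opnorm_leP k (l : Lsym k X F) c :
  `|l| <= c <-> forall v, (forall i, `|v i| <= 1) -> `|l v| <= c.
Proof.
split=> [lc v v1|lc]; first by apply: le_trans lc; exact: opnorm_ub.
by apply: ge_sup => [|_ [v v1 <-]]; [exact: (opnorm_has_sup l).1|exact: lc].
Qed.

Lemma jnorm_leP g m c : 0 <= c ->
  (jnorm g m <= c%:E)%E <->
  forall (x : K) v, (forall i, `|v i| <= 1) -> `|g m x v| <= c.
Proof.
move=> c0; rewrite sup0_leP//; split=> [gc x|gc _ [x _ <-]].
  by apply/opnorm_leP; rewrite -lee_fin; apply: gc; exists x.
by rewrite lee_fin; apply/opnorm_leP; exact: gc.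
Qed.

Definition jrem_scale n (x y : K) : R :=
  n.+1`!%:R / `|val x - val y| ^+ n.+1.

Lemma jrem_scale_gt0 n x y : x <> y -> 0 < jrem_scale n x y.
Proof.
move=> xy; rewrite divr_gt0 ?ltr0n ?fact_gt0// exprn_gt0// normr_gt0 subr_eq0.
by apply/eqP => /val_inj.
Qed.

Lemma jremnorm_leP g n k c : 0 <= c ->
  (jremnorm g n k <= c%:E)%E <->
  forall (x y : K) v, x <> y -> (forall i, `|v i| <= 1) ->
    `|jrem_scale n x y *: jrem g n k y x v| <= c.
Proof.
move=> c0; rewrite sup0_leP//; split=> [gc x y v xy v1|gc _ [[x y] /= xy <-]].
  have := gc _ (imageP _ (xy : [set xy | xy.1 <> xy.2] (x, y))).
  rewrite lee_fin /= mulrAC -ler_pdivlMl ?jrem_scale_gt0//.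
  move=> /opnorm_leP/(_ v v1).
  by rewrite ler_pdivlMl ?jrem_scale_gt0// normrZ gtr0_norm ?jrem_scale_gt0.
rewrite lee_fin mulrAC -ler_pdivlMl ?jrem_scale_gt0//; apply/opnorm_leP => v v1.
rewrite ler_pdivlMl ?jrem_scale_gt0//; have := gc x y v xy v1.
by rewrite normrZ gtr0_norm ?jrem_scale_gt0.
Qed.

Definition jet_weight rho m : R := m`!%:R * rho ^+ m * M m.

Lemma jet_weight_gt0 rho m : 0 < rho -> 0 < jet_weight rho m.
Proof.
move=> rho0; have [M0 _ _] := wM.
by rewrite !mulr_gt0 ?ltr0n ?fact_gt0 ?exprn_gt0.
Qed.

Lemma jet_weight_le rho rho' m : 0 < rho -> rho <= rho' ->
  jet_weight rho m <= jet_weight rho' m.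
Proof.
move=> rho0 rr'; have [M0 _ _] := wM; have rho'0 := lt_le_trans rho0 rr'.
rewrite ler_pM2r// ler_pM2l ?ltr0n ?fact_gt0// lerXn2r ?nnegrE//.
  exact: ltW.
exact: ltW.
Qed.

(* The norm [jnorm_rho] is the supremum of the norms of these linear maps, each
   divided by the weight of the given index. *)
Variant jet_component : nat -> (J -> F) -> Prop :=
| JetValue m (x : K) (v : 'I_m -> X) of (forall i, `|v i| <= 1) :
    jet_component m (fun g => g m x v)
| JetRemainder n k (x y : K) (v : 'I_k -> X) of
    x <> y & (forall i, `|v i| <= 1) :
    jet_component (n + k).+1 (fun g => jrem_scale n x y *: jrem g n k y x v).

Lemma jnorm_rho_leP rho c g : 0 < rho -> 0 <= c ->
  (jnorm_rho M rho g <= c%:E)%E <->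
  forall m psi, jet_component m psi -> `|psi g| <= c * jet_weight rho m.
Proof.
move=> rho0 c0; have w0 m := jet_weight_gt0 m rho0.
have cw0 m : 0 <= c * jet_weight rho m by rewrite mulr_ge0// ltW.
have weighted (x : \bar R) m : (x * (jet_weight rho m)^-1%:E <= c%:E)%E =
    (x <= (c * jet_weight rho m)%:E)%E by rewrite lee_pdivrMr// EFinM.
rewrite /jnorm_rho ge_max; split=> [/andP[]|gc].
  move=> /(sup0_leP _ c0) valc /(sup0_leP _ c0) remc m psi.
  case=> {m psi} [m x v v1|n k x y v xy v1].
    have := valc _ (imageP _ (I : [set: nat] m)).
    by rewrite weighted => /(jnorm_leP _ _ (cw0 m)); exact.
  have := remc _ (imageP _ (I : [set: nat * nat] (n, k))).
  by rewrite weighted => /(jremnorm_leP _ _ _ (cw0 _)); exact.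
apply/andP; split; apply/sup0_leP => //.
  move=> _ [m _ <-]; rewrite weighted; apply/jnorm_leP => // x v v1.
  exact: gc (JetValue x v1).
move=> _ [[n k] _ <-]; rewrite weighted; apply/jremnorm_leP => // x y v xy v1.
exact: gc (JetRemainder n xy v1).
Qed.

Lemma jnorm_rho_le_rho rho rho' c g : 0 < rho -> rho <= rho' -> 0 <= c ->
  (jnorm_rho M rho g <= c%:E)%E -> (jnorm_rho M rho' g <= c%:E)%E.
Proof.
move=> rho0 rr' c0; have rho'0 := lt_le_trans rho0 rr'.
move=> /(jnorm_rho_leP _ rho0 c0) gc; apply/jnorm_rho_leP => // m psi mpsi.
by rewrite (le_trans (gc m psi mpsi))// ler_wpM2l// jet_weight_le.
Qed.

Lemma jrem_eval g n k (x y : K) (v : 'I_k -> X) : jrem g n k y x v =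
  g k x v -
  \sum_(j < n.+1) j`!%:R^-1 *: g (j + k)%N y (padl j (val x - val y) v).
Proof.
have lsym_sum (l : 'I_n.+1 -> Lsym k X F) : (\sum_i l i) v = \sum_i l i v.
  by elim/big_rec2 : _ => // i a b _ <-.
have -> : jrem g n k y x v = g k x v - (\sum_(j < n.+1) j`!%:R^-1 *:
  lsym_plug j (g (j + k)%N y) (val x - val y)) v by [].
by rewrite lsym_sum.
Qed.

Lemma jet_component_bounded_linear (V : lmodType R) (B : set V) (S : V -> J)
    m psi :
  (forall k x (v : 'I_k -> X), (fun e => S e k x v) \in bounded_linear_on B) ->
  jet_component m psi -> psi \o S \in bounded_linear_on B.
Proof.
move=> SB [{}m x v _|n k x y v _ _]; first exact: SB.
have -> : (fun g => jrem_scale n x y *: jrem g n k y x v) \o S =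
    jrem_scale n x y *: ((fun e => S e k x v) - \sum_(j < n.+1)
      j`!%:R^-1 *: (fun e => S e (j + k)%N y (padl j (val x - val y) v))).
  apply/funext => e.
  rewrite -[LHS]/(jrem_scale n x y *: jrem (S e) n k y x v) jrem_eval.
  by rewrite -[RHS]/(_ *: (_ - (\sum_(j < n.+1) _) e)) fct_sumE.
by rewrite rpredZ// rpredB// rpred_sum// => j _; rewrite rpredZ.
Qed.

Lemma jet_component_linear m psi : jet_component m psi -> linear psi.
Proof.
move=> mpsi; suff /asboolP[] : psi \o id \in bounded_linear_on set0 by [].
apply: jet_component_bounded_linear mpsi => k x v; apply/asboolP.
by split=> //; exists 0 => _ [g []].
Qed.

Lemma jet_component_seminorm m psi :
  jet_component m psi -> seminorm (fun g => `|psi g|).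
Proof. by move=> /jet_component_linear/seminorm_norm_linear. Qed.

Lemma jnorm_rho0 rho : 0 < rho -> (jnorm_rho M rho (0 : J)%R <= 0%:E)%E.
Proof.
move=> rho0; apply/jnorm_rho_leP => // m psi mpsi.
by rewrite (seminorm0 (jet_component_seminorm mpsi)) mul0r.
Qed.

Lemma jnorm_rhoD_le rho c d g h : 0 < rho -> 0 <= c -> 0 <= d ->
  (jnorm_rho M rho g <= c%:E)%E -> (jnorm_rho M rho h <= d%:E)%E ->
  (jnorm_rho M rho (g + h)%R <= (c + d)%:E)%E.
Proof.
move=> rho0 c0 d0 /(jnorm_rho_leP _ rho0 c0) gc /(jnorm_rho_leP _ rho0 d0) hd.
apply/jnorm_rho_leP; rewrite ?addr_ge0// => m psi mpsi.
rewrite (le_trans ((jet_component_seminorm mpsi).1 _ _))// mulrDl.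
by rewrite lerD ?gc ?hd.
Qed.

Lemma jnorm_rhoZ_le rho (a c : R) g : 0 < rho -> 0 <= c ->
  (jnorm_rho M rho g <= c%:E)%E ->
  (jnorm_rho M rho (a *: g)%R <= (`|a| * c)%:E)%E.
Proof.
move=> rho0 c0 /(jnorm_rho_leP _ rho0 c0) gc.
apply/jnorm_rho_leP; rewrite ?mulr_ge0// => m psi mpsi.
by rewrite (jet_component_seminorm mpsi).2 -mulrA ler_wpM2l// gc.
Qed.

End jet_norms.

(** * Neighbourhoods of zero in spaces of jets and of smooth maps *)

Lemma lcs_initial_nbhs0 (R : realType) (V : lmodType R) (C : set V) (I : Type)
    (D : set I) (W : I -> lmodType R) (f : forall i, V -> W i)
    (Y : forall i, lcs (W i)) i (N : set (W i)) (P : set V) : D i ->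
  lcs_nbhs0 (Y i) N -> f i @^-1` N `<=` P -> lcs_nbhs0 (lcs_initial C D f Y) P.
Proof.
move=> Di YN NP; apply: filterS NP _; apply: sub_gen_smallest.
by exists i => //; exists N.
Qed.

Section absorption.
Context {R : realType} {E : lmodType R} (A : set E).

(* The sets N with a multiple that contains [S @` A] form a filter only among
   balanced sets, hence the condition on all small s. *)
Definition absorbing_image (V : lmodType R) (S : E -> V) : set_system V :=
  [set N | \forall s \near (0 : R)^'+, forall a, A a -> N (S (s *: a))].

Global Instance absorbing_image_filter (V : lmodType R) (S : E -> V) :
  Filter (absorbing_image S).
Proof.
split=> [|P Q|P Q PQ].
- exact: nearW.
- move=> absP absQ.
  apply: (@filterS2 _ 0^'+ _ _ _ _ _ absP absQ) => s sP sQ a Aa.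
  by split; [exact: sP|exact: sQ].
- by move=> absP; apply: (@filterS _ 0^'+ _ _ _ _ absP) => s sP a /sP/PQ.
Qed.

Lemma absorbing_image_initial (V : lmodType R) (S : E -> V) (C : set V)
    (I : Type) (D : set I) (W : I -> lmodType R) (f : forall i, V -> W i)
    (Y : forall i, lcs (W i)) :
  (forall i, D i -> lcs_nbhs0 (Y i) `<=` absorbing_image (f i \o S)) ->
  lcs_nbhs0 (lcs_initial C D f Y) `<=` absorbing_image S.
Proof.
move=> fS; apply: smallest_sub => _ [i Di [N YN <-]].
exact: fS YN.
Qed.

Lemma absorbing_image_bounded (V : lmodType R) (Y : lcs V)
    (S : {linear E -> V}) :
  (forall e, lcs_carrier Y (S e)) -> lcs_nbhs0 Y `<=` absorbing_image S ->
  lcs_bounded Y (S @` A).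
Proof.
move=> YS absS; split=> [_ [a _ <-]//|N /absS sN].
have [s [s0 {}sN]] : exists s : R, 0 < s /\ forall a, A a -> N (S (s *: a)).
  apply: (@filter_ex _ (0 : R)^'+); apply: filterI => //.
  exact: nbhs_right_gt.
exists s^-1; first by rewrite invr_gt0.
move=> _ [a Aa <-]; exists (S (s *: a)); first exact: sN.
by rewrite linearZ scalerA mulVf ?gt_eqF// scale1r.
Qed.

End absorption.

Lemma lt_pinfty_nat (R : realType) (x : \bar R) : (x < +oo)%E ->
  exists n : nat, (x <= n%:R%:E)%E.
Proof.
case: x => [r _|//|_]; last by exists 0; rewrite leNye.
by exists (Num.truncn r).+1; rewrite lee_fin ltW// truncnS_gt.
Qed.

Section jet_spaces.
Context {R : realType} {X F : normedModType R} (M : nat -> R) (K : set X).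
Hypothesis wM : weight_sequence M.
Local Notation J := (jet X F K).
Local Notation CMK := (@CM_rho R X F M K).

Lemma absconvex_CM_rho rho : 0 < rho -> absconvex (lcs_carrier (CMK rho)).
Proof.
move=> rho0; split.
  exists 0; split=> [k|]; first exact: (@cst_continuous _ _ (0 : Lsym k X F)).
  exact: le_lt_trans (jnorm_rho0 K wM rho0) (ltry _).
move=> a b g h _ [gc /lt_pinfty_nat[n gn]] [hc /lt_pinfty_nat[m hm]]; split.
  move=> k; suff : continuous (fun y => a *: g k y + b *: h k y) by [].
  move=> y; have ag_cvg : a *: g k z @[z --> y] --> a *: g k y.
    exact: cvgZ (cvg_cst a) (gc k y).
  have bh_cvg : b *: h k z @[z --> y] --> b *: h k y.
    exact: cvgZ (cvg_cst b) (hc k y).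
  exact: cvgD ag_cvg bh_cvg.
have agn := jnorm_rhoZ_le wM a rho0 (ler0n R n) gn.
have bhm := jnorm_rhoZ_le wM b rho0 (ler0n R m) hm.
apply: le_lt_trans (jnorm_rhoD_le wM rho0 _ _ agn bhm) (ltry _);
  by rewrite mulr_ge0.
Qed.

Lemma CM_rho_sub rho rho' : 0 < rho -> rho <= rho' ->
  lcs_carrier (CMK rho) `<=` lcs_carrier (CMK rho').
Proof.
move=> rho0 rr' g [gc /lt_pinfty_nat[n gn]]; split=> //.
exact: le_lt_trans (jnorm_rho_le_rho wM rho0 rr' (ler0n R n) gn) (ltry _).
Qed.

Lemma absconvex_CM_Roumieu :
  absconvex (lcs_carrier (CM_compact M K Roumieu : lcs J)).
Proof.
apply: absconvex_bigcup => [|rho|rho tau rho0 tau0].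
- by exists 1; exact: ltr01.
- exact: absconvex_CM_rho.
exists (Num.max rho tau); split; first by rewrite /= lt_max rho0.
- by apply: CM_rho_sub; rewrite // le_max lexx.
- by apply: CM_rho_sub; rewrite // le_max lexx orbT.
Qed.

Lemma CM_compact_eval_nbhs0 (x : K) (v : 'I_0 -> X) (b : flavour) :
  lcs_nbhs0 (CM_compact M K b) [set g : J | `|g 0 x v| <= 1].
Proof.
have evs : seminorm (fun g : J => `|g 0 x v|).
  exact: (seminorm_norm_linear (f := fun g : J => g 0 x v)).
have evM rho (g : J) : 0 < rho ->
    (jnorm_rho M rho g < 1%:E)%E -> `|g 0 x v| <= 1.
  move=> rho0 /ltW/(jnorm_rho_leP wM _ rho0 ler01) g1; have [_ M0 _] := wM.
  have v1 i : `|v i| <= 1 by case: i.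
  by have := g1 _ _ (JetValue x v1); rewrite /jet_weight expr0 M0 !mulr1.
case: b.
  apply: (@lcs_initial_nbhs0 _ _ _ _ _ _ _ _ 1
    [set g : J | `|g 0 x v| <= 1]) => //.
    exact: ltr01.
  by exists 1 => // g [_]; exact: evM.
exists (lcs_carrier (CM_compact M K Roumieu) `&` [set g : J | `|g 0 x v| <= 1]).
split=> [||rho rho0|g []//].
- apply: absconvexI; first exact: absconvex_CM_Roumieu.
  exact: absconvex_seminorm_ball.
- by move=> g [].
- exists 1 => // g [Xg g1]; split; first by exists rho.
  exact: evM g1.
Qed.

Section bounded_families.
Context {E : lmodType R} (S : E -> J).

Lemma jet_linear : (forall k x v, linear (fun e => S e k x v)) -> linear S.
Proof.
move=> Sl a e e'; apply: functional_extensionality_dep => k.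
by apply/funext => x; apply/val_inj/funext => v; exact: Sl.
Qed.

Lemma absorbing_image_CM_rho (A : set E) rho c :
  0 < rho -> 0 <= c -> linear S -> (forall e k, continuous (S e k)) ->
  (forall e, A e -> (jnorm_rho M rho (S e) <= c%:E)%E) ->
  lcs_nbhs0 (CMK rho) `<=` absorbing_image A S.
Proof.
move=> rho0 c0 Sl Sc Ac N [e e0 eN].
have d0 : 0 < e / (c + 1) by rewrite divr_gt0// ltr_wpDl.
have small : \forall s \near (0 : R)^'+, 0 < s < e / (c + 1).
  near=> s; apply/andP; split; near: s; first exact: nbhs_right_gt.
  exact: nbhs_right_lt.
apply: (@filterS _ 0^'+ _ _ _ _ small) => s /andP[s0 se] a Aa; apply: eN.
have Ssa : (jnorm_rho M rho (S (s *: a)) <= (s * c)%:E)%E.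
  rewrite (GRing.semilinear_linear Sl).1 -[X in (X * c)%:E](gtr0_norm s0).
  by apply: jnorm_rhoZ_le => //; exact: Ac.
split; first by split; [exact: Sc|exact: le_lt_trans Ssa (ltry _)].
apply: le_lt_trans Ssa _; rewrite lte_fin.
move: se; rewrite ltr_pdivlMr ?ltr_wpDl// mulrDr mulr1.
by apply: le_lt_trans; rewrite lerDl ltW.
Unshelve. all: by end_near. Qed.

Variable B : set E.
Hypothesis bB : banach_disk B.
Hypothesis SB : forall k x (v : 'I_k -> X),
  (fun e => S e k x v) \in bounded_linear_on B.

Lemma CM_rho_uniformly_bounded (rho : nat -> R) : (forall n, 0 < rho n) ->
  (forall e, exists n, (jnorm_rho M (rho n) (S e) <= n%:R%:E)%E) ->
  exists n, exists2 c, 0 <= c &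
    forall e, B e -> (jnorm_rho M (rho n) (S e) <= c%:E)%E.
Proof.
move=> rho0 Sn; pose w n m := jet_weight M (rho n) m.
have w0 n m : 0 < w n m by exact: jet_weight_gt0.
pose P n := [set p : E -> R | exists m psi, jet_component m psi /\
  p = fun e => (w n m)^-1 * `|psi (S e)|].
have [n _ [m [psi [mpsi ->]]]|e Be|n [c Pc]] :=
  banach_disk_uniform_boundedness (P := P) bB.
- have /asboolP[psiSl [d psiSd]] := jet_component_bounded_linear SB mpsi.
  have wi : 0 <= (w n m)^-1 by rewrite invr_ge0 ltW.
  split.
    apply: (seminorm_mul (p := fun e => `|psi (S e)|)) => //.
    exact: seminorm_norm_linear.
  exists ((w n m)^-1 * d) => _ [e Be <-].
  by rewrite ler_wpM2l// psiSd//; exists e.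
- have [n /(jnorm_rho_leP wM _ (rho0 n) (ler0n R n)) Sen] := Sn e.
  exists n => _ [m [psi [mpsi ->]]].
  by rewrite ler_pdivrMl// mulrC Sen.
exists n, (Num.max c 0) => [|e Be]; first by rewrite le_max lexx orbT.
apply/jnorm_rho_leP => // [|m psi mpsi]; first by rewrite le_max lexx orbT.
rewrite -ler_pdivrMr ?w0// mulrC le_max; apply/orP; left.
by apply: (Pc (fun e => (w n m)^-1 * `|psi (S e)|)) => //; exists m, psi.
Qed.

Lemma absorbing_image_CM_compact (A : set E) (b : flavour) : A `<=` B ->
  (forall e, lcs_carrier (CM_compact M K b) (S e)) ->
  lcs_nbhs0 (CM_compact M K b) `<=` absorbing_image A S.
Proof.
move=> AB; have Sl : linear S.
  by apply: jet_linear => k x v; have /asboolP[] := SB x v.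
case: b => Sb.
  have Sc e k : continuous (S e k) by have [_ /(_ 1 ltr01)[]] := Sb e.
  apply: absorbing_image_initial => rho rho0.
  have [|_ [c c0 Bc]] := CM_rho_uniformly_bounded (fun=> rho0).
    by move=> e; have [_ /(_ rho rho0)[_ /lt_pinfty_nat]] := Sb e.
  by apply: (absorbing_image_CM_rho rho0 c0 Sl Sc) => e /AB; exact: Bc.
have Sc e k : continuous (S e k) by have [rho _ []] := Sb e.
have n0 n : 0 < n.+1%:R :> R by rewrite ltr0n.
have [e|n [c c0 Bc]] := CM_rho_uniformly_bounded n0.
  have [rho rho0 [_ /lt_pinfty_nat[m Sm]]] := Sb e.
  pose n := maxn m (Num.truncn rho); exists n.
  have mn : (m%:R <= n%:R :> R) by rewrite ler_nat leq_maxl.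
  have rhon : rho <= n.+1%:R.
    by rewrite (le_trans (ltW (truncnS_gt rho)))// ler_nat ltnS leq_maxr.
  apply: (jnorm_rho_le_rho wM rho0 rhon) => //.
  by apply: le_trans Sm _; rewrite lee_fin.
move=> N [N' [_ _ N'nbhs N'N]]; apply: filterS N'N _.
apply: (absorbing_image_CM_rho (n0 n) c0 Sl Sc) (N'nbhs _ (n0 n)) => e /AB.
exact: Bc.
Qed.

End bounded_families.
End jet_spaces.

(** * Spaces of ultradifferentiable maps *)

Section CM_open.
Context {R : realType} {X F : normedModType R} (M : nat -> R) (U : set X).
Hypothesis wM : weight_sequence M.

Lemma absorbing_image_CM_open (V : lmodType R) (A B : set V) (b : flavour)
    (f : V -> (U -> F)) : banach_disk B -> A `<=` B -> algebraically_open U ->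
  (forall x, f ^~ x \in bounded_linear_on B) ->
  (forall e, lcs_carrier (CM_open M U b) (f e)) ->
  lcs_nbhs0 (CM_open M U b) `<=` absorbing_image A f.
Proof.
move=> bB AB oU fB fCM; apply: absorbing_image_initial => K KP.
apply: (absorbing_image_CM_compact wM bB) => // [k x v|e].
  apply: bounded_linear_on_frechet_jet => // [e|]; first by have [] := fCM e.
  by have [_ _ KU] := KP; exact: KU (set_mem (valP x)).
by have [_] := fCM e; exact.
Qed.

Lemma CM_open_eval_nbhs0 (b : flavour) (x : U) :
  lcs_nbhs0 (CM_open M U b) [set f : U -> F | frechet_smooth f -> `|f x| <= 1].
Proof.
pose K := [set val x]; pose xK : K := exist _ (val x) (mem_set erefl).
apply: (@lcs_initial_nbhs0 _ _ _ _ _ _ _ _ K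
  [set g : jet X F K | `|g 0 xK (fun=> 0)| <= 1]).
- split; first exact: compact_set1.
    by move=> y z t /set_mem -> /set_mem ->; apply/mem_set; rewrite convmm.
  by move=> _ ->; exact: set_mem (valP x).
- exact: CM_compact_eval_nbhs0.
- move=> f /= f1 sf; rewrite -((frechet_jetP sf).1 x (fun=> 0)).
  exact: f1.
Qed.

End CM_open.

Lemma trace_algebraically_open (R : realType) (F : convenientType R) (U : set F)
    (D : bdisk F) : algebraically_open U -> algebraically_open (@trace R F U D).
Proof. by move=> oU x h Ux; exact: oU (EB_incl x) (EB_incl h) Ux. Qed.

Section CM.
Context {R : realType} {F G : convenientType R} (M : nat -> R) (U : set F).
Hypothesis wM : weight_sequence M.

Lemma trace_incl_surj (x : U) : exists D (y : @trace R F U D), trace_incl y = x.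
Proof.
have bx : lcs_bounded (lcs_of_tvs F) [set val x].
  by apply/lcs_boundedP => p _; exists (p (val x)) => _ [_ -> <-].
have xP : val x \in EB_pred (hull_bdisk bx).
  by apply/mem_set; apply: sub_gen_smallest; exact: sub_gen_smallest.
have Ux : @trace R F U _ (MkEB xP) by exact: set_mem (valP x).
by exists (hull_bdisk bx), (exist _ (MkEB xP) (mem_set Ux)); exact/val_inj.
Qed.

Lemma CM_eval_nbhs0 (b : flavour) (l : {linear G -> R^o}) (x : U) :
  continuous l -> lcs_nbhs0 (CM G M b U)
    [set f | lcs_carrier (CM G M b U) f -> `|l (f x)| <= 1].
Proof.
move=> lc; have [D [y yx]] := trace_incl_surj x.
apply: (@lcs_initial_nbhs0 _ _ _ _ _ _ _ _ (l, D)
  [set g : @trace R F U D -> R^o | frechet_smooth g -> `|g y| <= 1]) => //.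
  exact: CM_open_eval_nbhs0.
move=> f /= f1 [_ fCM]; rewrite -yx; apply: f1.
by have [] := fCM (l, D) lc.
Qed.

End CM.

Lemma bounded_image_functional (R : realType) (V W : lmodType R) (X : lcs W)
    (T : {linear V -> W}) (phi : {scalar W}) (A : set V) :
  (forall e, lcs_carrier X (T e)) -> lcs_bounded X (T @` A) ->
  lcs_nbhs0 X [set w | lcs_carrier X w -> `|phi w| <= 1] ->
  has_ubound [set `|phi (T a)| | a in A].
Proof.
move=> TX [_ bTA] /bTA[r r0 rN]; exists r => _ [a Aa <-].
have [w w1 wE] := rN _ (imageP T Aa).
have Ta : w = T (r^-1 *: a) by rewrite linearZ /= -wE scalerK ?gt_eqF.
rewrite -wE linearZ /= normrM gtr0_norm// ger_pMr//; apply: w1.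
by rewrite Ta.
Qed.

Section uniform_boundedness_principle.
Context {R : realType} {E F G : convenientType R} (M : nat -> R) (b : flavour)
  (U : set F) (T : {linear E -> (U -> G)}).
Hypotheses (wM : weight_sequence M)
  (TU : forall e : E, lcs_carrier (CM G M b U) (T e)).

Lemma bounded_map_CM_of_eval : cinfty_open U ->
  (forall x : U, bounded_map (lcs_of_tvs E) (lcs_of_tvs G) (fun e => T e x)) ->
  bounded_map (lcs_of_tvs E) (CM G M b U) T.
Proof.
move=> oU Tx A bA; apply: absorbing_image_bounded => //.
apply: absorbing_image_initial => -[l D] /= lc.
have bB := bdisk_banach_disk (hull_bdisk bA).
apply: (absorbing_image_CM_open wM bB).
- exact: sub_gen_smallest.
- exact: trace_algebraically_open (cinfty_open_algebraically_open oU).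
- move=> x; apply/asboolP; split=> [a e e'|].
    rewrite /= linearP.
    exact: (linearP l a (T e (trace_incl x)) (T e' (trace_incl x))).
  have /lcs_boundedP bTx := Tx (trace_incl x) _ (bdisk_bounded (hull_bdisk bA)).
  have [c Bc] := bTx _ (normr_continuous_seminorm (linearP l) lc).
  exists c => _ [e Be <-]; apply: Bc.
  by exists (T e (trace_incl x)) => //; exists e.
- by move=> e; have [_ /(_ (l, D) lc)] := TU e.
Qed.

Lemma bounded_map_CM_eval (x : U) : bounded_map (lcs_of_tvs E) (CM G M b U) T ->
  bounded_map (lcs_of_tvs E) (lcs_of_tvs G) (fun e => T e x).
Proof.
move=> bT A bA; apply: weakly_bounded_bounded => l lc.
have phil : scalar (fun f : U -> G => l (f x)).
  by move=> a f g; rewrite -[(_ + _) x]/(a *: f x + g x) linearP.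
pose phi : {scalar (U -> G)} := HB.pack (fun f : U -> G => l (f x) : R)
  (GRing.isLinear.Build R (U -> G) R *%R _ phil).
have [|c Ac] := bounded_image_functional (phi := phi) TU (bT A bA).
  exact: CM_eval_nbhs0.
by exists c => _ [_ [a Aa <-] <-]; apply: Ac; exists a.
Qed.

End uniform_boundedness_principle.

Theorem theorem6p1 (R : realType) (M : nat -> R) (wM : weight_sequence M)
    (b : flavour) (E F G : convenientType R) (U : set F) (oU : cinfty_open U)
    (T : {linear E -> (U -> G)})
    (TU : forall e : E, lcs_carrier (CM G M b U) (T e)) :
  bounded_map (lcs_of_tvs E) (CM G M b U) T <->
  forall x : U, bounded_map (lcs_of_tvs E) (lcs_of_tvs G) (fun e => T e x).
Proof.
split=> [bT x|Tx]; first exact: bounded_map_CM_eval wM TU x bT.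
exact: bounded_map_CM_of_eval wM TU oU Tx.
Qed.
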